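(* Let $\mathcal{F}$ be a foliation of degree $3$ on $\mathbb{P}^2(\mathbb{C})$, defined in the affine chart $(x,y)$ by the polynomial vector field $\mathrm{X}=\mathrm{X}_1\frac{\partial}{\partial x}+\mathrm{X}_2\frac{\partial}{\partial y}$ with $\mathrm{X}_1,\mathrm{X}_2$ without common factor, and let $P(t)=at^2+bt+c$, $a,b,c\in\mathbb{C}[x,y]$, be the polynomial attached to $\mathrm{X}$ (see context). Suppose that the discriminant $\Delta(P)=b^2-4ac\in\mathbb{C}[x,y]$ is a square $s^2$ in $\mathbb{C}[x,y]$, and let $r_1,r_2\in\mathbb{C}(x,y)$ be the roots of $P$. Then the maps $$\mathcal{T}_i=(x+r_i\mathrm{X}_1,\;y+r_i\mathrm{X}_2),\qquad i=1,2,$$ are birational and periodic of period three, and $\mathcal{T}_1\circ\mathcal{T}_2=\mathrm{id}$.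
   Context: The degree of a foliation on $\mathbb{P}^2(\mathbb{C})$ is the number of its tangency points with a generic line. The polynomial $P$: for a point $m=(x,y)$ and a complex number $t$, let $\mathrm{Y}_1(t)$ and $\mathrm{Y}_2(t)$ be the components of the vector field $\mathrm{X}$ evaluated at the point $m+t\mathrm{X}(m)$, i.e. $\mathrm{Y}_j(t)=\mathrm{X}_j\big(x+t\mathrm{X}_1(x,y),\,y+t\mathrm{X}_2(x,y)\big)$. Set $$Q(t)=\mathrm{Y}_1(t)\mathrm{X}_2-\mathrm{Y}_2(t)\mathrm{X}_1\in\mathbb{C}[x,y][t].$$ The roots of $Q$ correspond to the three points of the line $t\mapsto m+t\mathrm{X}(m)$ at which this line is tangent to $\mathcal{F}$. The polynomial $Q$ is divisible by $t$ and is written $Q(t)=tP(t)$ with $P(t)=at^2+bt+c$ and $a,b,c\in\mathbb{C}[x,y]$. *)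

(* Defs.v *)
From HB Require Import structures.
From mathcomp Require Import all_boot all_order all_algebra.
From mathcomp Require Import fraction complex mpoly reals.

Set Implicit Arguments.
Unset Strict Implicit.
Unset Printing Implicit Defensive.

Import GRing.Theory.
Local Open Scope ring_scope.
Local Notation "x %:F" := (tofrac x) : ring_scope.

Definition mpoly_dvd (C : fieldType) (n : nat) (p q : {mpoly C[n]}) : Prop :=
  exists r : {mpoly C[n]}, q = r * p.

(* The units of [{mpoly C[n]}] are the nonzero constants. *)
Definition no_common_factor (C : fieldType) (n k : nat)
    (f : 'I_k -> {mpoly C[n]}) : Prop :=
  forall p : {mpoly C[n]},
    (forall i, mpoly_dvd p (f i)) -> p \is a GRing.unit.

(** * Foliations on the projective plane *)

(* A foliation on P^2 is given by a homogeneous 1-form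
   w = w_0 dz_0 + w_1 dz_1 + w_2 dz_2 on C^3 which is annihilated by the radial
   vector field and has no divisorial zeros.  Integrability is automatic.  The
   field [fol_exp] is the degree of the coefficients and not the degree of the
   foliation, for which see [has_degree]. *)
Record foliation (C : fieldType) := Foliation {
  fol_exp : nat;
  fol_form : 'I_3 -> {mpoly C[3]};
  fol_homog : forall i, fol_form i \is fol_exp.-homog;
  fol_radial : \sum_(i < 3) 'X_i * fol_form i = 0;
  fol_saturated : no_common_factor fol_form
}.

(* Points and lines of P^2 are represented by nonzero vectors of homogeneous
   coordinates. *)
Definition same_point (C : fieldType) (u v : 'rV[C]_3) : Prop :=
  exists2 k : C, k != 0 & u = k *: v.

Definition pairing (C : fieldType) (l v : 'rV[C]_3) : C :=
  \sum_(i < 3) l 0 i * v 0 i.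

Definition form_at (C : fieldType) (F : foliation C) (p : 'rV[C]_3) :
  'rV[C]_3 := \row_(i < 3) (fol_form F i).@[fun j => p 0 j].

(* [p] is a point of the line [l] at which the restriction of the 1-form to
   [l] vanishes: either the leaf through [p] is tangent to [l], or [p] is a
   singular point of [F] on [l] (a generic line has no such point, since the
   singular set is finite). *)
Definition tangency_point (C : fieldType) (F : foliation C)
    (l p : 'rV[C]_3) : Prop :=
  [/\ p != 0, pairing l p = 0 &
      forall v : 'rV[C]_3, pairing l v = 0 -> pairing (form_at F p) v = 0].

(* The number of tangency points with a generic line is [d].  "Generic" means
   outside some curve g = 0 of the dual plane; every proper Zariski closed
   subset of the dual plane lies in such a curve. *)
Definition has_degree (C : fieldType) (F : foliation C) (d : nat) : Prop :=
  exists (e : nat) (g : {mpoly C[3]}),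
    [/\ g != 0, g \is e.-homog &
        forall l : 'rV[C]_3, l != 0 -> g.@[fun j => l 0 j] != 0 ->
          exists p : 'I_d -> 'rV[C]_3,
            [/\ forall i, tangency_point F l (p i),
                forall i j, same_point (p i) (p j) -> i = j &
                forall q, tangency_point F l q -> exists i, same_point q (p i)]].

(* The affine chart is (x, y) |-> [x : y : 1]. *)
Definition chart (C : fieldType) (p : {mpoly C[3]}) : {mpoly C[2]} :=
  p \mPo [tuple 'X_0; 'X_1; 1].

(* A vector field X_0 d/dx + X_1 d/dy without common factor spans the
   distribution of [F] on the chart iff it lies in the kernel of the restricted
   1-form w_0(x,y,1) dx + w_1(x,y,1) dy. *)
Definition defined_by (C : fieldType) (F : foliation C)
    (X : 'I_2 -> {mpoly C[2]}) : Prop :=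
  chart (fol_form F 0) * X 0 + chart (fol_form F 1) * X 1 = 0.

(** * The polynomial P attached to a vector field *)

Definition shifted_field (C : fieldType) (X : 'I_2 -> {mpoly C[2]}) (j : 'I_2) :
    {poly {mpoly C[2]}} :=
  mmap (fun c : C => (c%:MP)%:P) (fun i => ('X_i)%:P + X i *: 'X) (X j).

Definition Qpoly (C : fieldType) (X : 'I_2 -> {mpoly C[2]}) :
    {poly {mpoly C[2]}} :=
  shifted_field X 0 * (X 1)%:P - shifted_field X 1 * (X 0)%:P.

(* P(t) = Q(t) / t; the constant term X_0 X_1 - X_1 X_0 of Q vanishes. *)
Definition Ppoly (C : fieldType) (X : 'I_2 -> {mpoly C[2]}) :
    {poly {mpoly C[2]}} := drop_poly 1 (Qpoly X).

Definition quad_disc (R : comNzRingType) (P : {poly R}) : R :=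
  P`_1 ^+ 2 - 4%:R * P`_2 * P`_0.

(* [r1] and [r2] are the roots, with multiplicity, of the quadratic polynomial
   [P] in the field of fractions. *)
Definition quad_roots (R : idomainType) (P : {poly R}) (r1 r2 : {fraction R}) :
    Prop :=
  P`_2 != 0 /\
  map_poly (@tofrac R) P = (P`_2)%:F *: (('X - r1%:P) * ('X - r2%:P)).

(** * Rational self-maps of the plane *)

(* The field C(x, y); a rational self-map of the plane is given by its two
   components in the affine chart. *)
Notation ratfun C := {fraction {mpoly C[2]}}.

Definition ratmap (C : fieldType) := 'I_2 -> ratfun C.

Definition mpoly_subst (C : fieldType) (p : {mpoly C[2]}) (S : ratmap C) :
    ratfun C := mmap (fun c : C => (c%:MP)%:F) S p.

(* [h] is the result of substituting [S] in the rational function [f].  The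
   substitution is only defined when some denominator of [f] does not vanish
   identically along [S]; the value does not depend on the fraction p/q. *)
Definition ratfun_subst (C : fieldType) (f : ratfun C) (S : ratmap C)
    (h : ratfun C) : Prop :=
  exists p q : {mpoly C[2]},
    [/\ f = p%:F / q%:F, mpoly_subst q S != 0 &
        h = mpoly_subst p S / mpoly_subst q S].

(* The composition T o S is defined and equal to U. *)
Definition is_comp (C : fieldType) (T S U : ratmap C) : Prop :=
  forall j, ratfun_subst (T j) S (U j).

Definition rid (C : fieldType) : ratmap C := fun j => ('X_j)%:F.

Definition birational (C : fieldType) (T : ratmap C) : Prop :=
  exists S : ratmap C, is_comp T S (@rid C) /\ is_comp S T (@rid C).

Fixpoint is_iter (C : fieldType) (n : nat) (T U : ratmap C) : Prop :=
  match n with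
  | 0 => U =1 @rid C
  | m.+1 => exists2 V : ratmap C, is_iter m T V & is_comp T V U
  end.

Definition periodic (C : fieldType) (n : nat) (T : ratmap C) : Prop :=
  [/\ (0 < n)%N, is_iter n T (@rid C) &
      forall k, (0 < k < n)%N -> ~ is_iter k T (@rid C)].

Definition Tmap (C : fieldType) (X : 'I_2 -> {mpoly C[2]}) (r : ratfun C) :
    ratmap C := fun j => ('X_j)%:F + r * (X j)%:F.

(* Main.v *)
Require Import Defs.
From HB Require Import structures.
From mathcomp Require Import all_boot all_order all_algebra.
From mathcomp Require Import fraction complex mpoly reals separable ring boolp.

Set Implicit Arguments.
Unset Strict Implicit.
Unset Printing Implicit Defensive.

Import GRing.Theory.
Local Open Scope ring_scope.

(** Why the theorem holds.  Write lines as [y = p x + q].  The points of such a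
    line where it is tangent to the foliation are the zeros in [x] of the
    tangency polynomial [G = p X_0(x, q + p x) - X_1(x, q + p x)], seen as an
    element of [C[p, q][x]].  In the coordinates [(x, y, p)] it is
    [p X_0 - X_1], linear in [p] with coprime coefficients, hence prime.
    Sending [(p, q)] to the tangent line at the generic point [m = (x, y)],
    that is [p |-> X_1 / X_0] and [q |-> y - x X_1 / X_0], and the variable of
    [G] to [x], kills exactly the multiples of [G] ([tangent_eval_ker]).

    Primality has three uses.
    - [G] is coprime to its derivative, so that the number of tangency points on
      a generic line is the degree of [G] in [x]: this degree is 3
      ([size_tan]).  Two facts about the foliation enter here.  The vector field
      is a constant multiple of [(w_1, - w_0)], because a common factor of the
      chart of the 1-form would homogenize to a common factor of the form
      ([fol_chart]); and a generic line is not tangent at infinity, since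
      otherwise the line at infinity would divide the form
      ([infinity_poly_neq0]).
    - Over the tangent line at [m], [G] becomes [Q] up to an affine change of
      variable and a factor ([Qpoly_along]).  So [Q] has degree 3 with a simple
      root at 0: the leading coefficient of [P] is nonzero and neither of its
      roots is 0.
    - A polynomial that does not vanish at [m] does not vanish at another
      tangency point of the same line ([no_common_root]).  Hence substituting
      [T_i] is injective on [C[x, y]] and extends to an endomorphism
      [sigma_i] of [C(x, y)], and the vector field at [T_i(m)] is a nonzero
      multiple of the field at [m].

    The tangent line at [T_i(m)] is therefore the tangent line at [m], so
    [sigma_i] permutes the three tangency points [m, T_1, T_2]
    ([endo_permutes]): it sends [T_i] either to the third point, and then the
    third point to [m], or to [m], fixing the third point.  The second
    possibility is excluded by composing the two endomorphisms, because it would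
    force one of them to be the identity ([endo_shift]); this is the remark that
    a normal cubic extension has a Galois group of order three.  What is left
    says that [T_1] and [T_2] are inverse to each other and
    [T_1 o T_1 = T_2]. *)

(** * Divisibility in C[x, y] *)

Section EuclidPoly.
Variable C : closedFieldType.
Implicit Types (f g h e r : {poly {poly C}}) (u : {poly C}).

Definition coef_eval (a : C) : {poly {poly C}} -> {poly C} :=
  map_poly (horner_eval a).
Definition scalar_XsubC (a : C) : {poly {poly C}} := ('X - a%:P)%:P.

Lemma scalar_XsubC_neq0 a : scalar_XsubC a != 0.
Proof. by rewrite polyC_eq0 polyXsubC_eq0. Qed.

Lemma coef_eval_eq0_dvd a f : coef_eval a f = 0 -> exists g, f = scalar_XsubC a * g.
Proof.
move=> f0; exists (map_poly (fun c : {poly C} => c %/ ('X - a%:P)) f).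
apply/polyP=> i; rewrite coefCM coef_map_id0 ?div0p // mulrC divpK //.
rewrite dvdp_XsubCl; have /polyP/(_ i) := f0.
by rewrite coef_map coef0 => /eqP.
Qed.

Lemma coef_eval_scalar_XsubC a g : coef_eval a (scalar_XsubC a * g) = 0.
Proof. by rewrite /coef_eval rmorphM /= /scalar_XsubC map_polyC /= /horner_eval
  !hornerE subrr mul0r. Qed.

Lemma scalar_XsubC_prime a f g h :
  f * g = scalar_XsubC a * h -> coef_eval a f = 0 \/ coef_eval a g = 0.
Proof.
move=> fgh; have : coef_eval a f * coef_eval a g == 0.
  by rewrite -[_ * _](rmorphM (map_poly (horner_eval a))) fgh;
    apply/eqP/coef_eval_scalar_XsubC.
by rewrite mulf_eq0 => /orP[] /eqP; [left|right].
Qed.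

(** A scalar is a product of factors [x - a], each of which is prime and divides
    [e] as soon as it does not divide [f]; so all of them cancel. *)
Lemma strip_scalar u f e r :
  u != 0 -> (forall a, coef_eval a f <> 0) -> f * e = u%:P * r ->
  exists e', r = e' * f.
Proof.
have [n] := ubnP (size u); elim: n u e => // n IHn u e ltun u0 fprim feur.
have [/closed_rootP[a /factor_theorem[u' def_u]]|] :=
  boolP (size u != 1).
  have e0 : coef_eval a e = 0.
    have [|//|//] := @scalar_XsubC_prime a f e (u'%:P * r).
      by rewrite feur def_u polyCM /scalar_XsubC; ring.
    by move/fprim.
  have [e' def_e] := coef_eval_eq0_dvd e0.
  have u'0 : u' != 0 by apply: contraNneq u0 => u'0; rewrite def_u u'0 mul0r.
  apply: (IHn u' e') => //.
    by rewrite def_u size_Mmonic ?monicXsubC // size_XsubC addn2 in ltun.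
  apply: (mulfI (scalar_XsubC_neq0 a)); rewrite mulrCA -def_e feur def_u polyCM
    /scalar_XsubC; ring.
rewrite negbK => /size_poly1P[c c0 def_u]; exists ((c^-1)%:P%:P * e).
rewrite -mulrA [e * f]mulrC feur def_u mulrA -!polyCM.
by rewrite mulVf // mul1r.
Qed.

(** Dividing by a factor [x - a] lowers the degree of the leading coefficient,
    so only finitely many can be removed. *)
Lemma primitive_part f : f != 0 ->
  exists2 u, u != 0 & exists2 f', f = u%:P * f' & forall a, coef_eval a f' <> 0.
Proof.
have [n] := ubnP (size (lead_coef f)); elim: n f => // n IHn f ltfn f0.
case: (pselect (exists a, coef_eval a f = 0)) => [[a /coef_eval_eq0_dvd[g
  def_f]]|prim].
  have g0 : g != 0 by apply: contraNneq f0 => g0; rewrite def_f g0 mulr0.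
  have [|u u0 [f' def_g prim]] := IHn g _ g0.
    move: ltfn; rewrite def_f lead_coefM lead_coefC mulrC size_Mmonic ?monicXsubC
      ?lead_coef_eq0 //.
    by rewrite size_XsubC addn2.
  exists (('X - a%:P) * u); first by rewrite mulf_neq0 ?polyXsubC_eq0.
  by exists f' => //; rewrite def_f def_g mulrA polyCM.
exists 1; first exact: oner_neq0.
by exists f; rewrite ?mul1r // => a fa; apply: prim; exists a.
Qed.

(** The scalar factors of [f] do not divide [g], hence divide [h], and can be
    removed from both sides.  Once [f] is primitive, a Bezout relation between
    [f] and [g] gives a scalar multiple of [h] that [f] divides, unless the
    pseudo-gcd of [f] and [g] is not scalar; in that case its primitive part is
    a common factor.  The two size conditions say that [d] is a nonzero
    constant. *)
Lemma euclid_poly f g h e :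
    (forall d d1 d2, f = d1 * d -> g = d2 * d -> size d = 1 /\ size d`_0 = 1) ->
  f != 0 -> f * e = g * h -> exists e', h = e' * f.
Proof.
move=> cop f0; have [u u0 [f' def_f prim]] := primitive_part f0.
have f'0 : f' != 0 by apply: contraNneq f0 => f'0; rewrite def_f f'0 mulr0.
have [n] := ubnP (size u); elim: n u f h e f0 u0 def_f cop => // n IHn u f h e f0
  u0 def_f cop ltun fegh.
have [/closed_rootP[a /factor_theorem[u' def_u]]|] := boolP (size u != 1).
  have h0 : coef_eval a h = 0.
    have [||//] := @scalar_XsubC_prime a g h (u'%:P * f' * e).
      by rewrite -fegh def_f def_u polyCM /scalar_XsubC; ring.
    move=> /coef_eval_eq0_dvd[g' def_g].
    have [||_] := cop (scalar_XsubC a) (u'%:P * f') g'.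
    - by rewrite def_f def_u polyCM /scalar_XsubC; ring.
    - by rewrite def_g mulrC.
    - by rewrite /scalar_XsubC coefC size_XsubC.
  have [h' def_h] := coef_eval_eq0_dvd h0.
  have u'0 : u' != 0 by apply: contraNneq u0 => u'0; rewrite def_u u'0 mul0r.
  have [||||e' def_h'] := IHn u' (u'%:P * f') h' e _ u'0 erefl.
  - by rewrite mulf_neq0 ?polyC_eq0.
  - move=> d d1 d2 def_d1 def_d2; apply: (cop d (scalar_XsubC a * d1) d2) => //.
    rewrite -mulrA -def_d1 def_f def_u polyCM /scalar_XsubC; ring.
  - by rewrite def_u size_Mmonic ?monicXsubC // size_XsubC addn2 in ltun.
  - apply: (mulfI (scalar_XsubC_neq0 a)).
    transitivity (f * e); first by rewrite def_f def_u polyCM /scalar_XsubC; ring.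
    rewrite fegh def_h; ring.
  by exists e'; rewrite def_h def_h' def_f def_u polyCM /scalar_XsubC; ring.
rewrite negbK => /size_poly1P[c c0 def_u].
have prim_f a : coef_eval a f <> 0.
  rewrite /coef_eval def_f def_u rmorphM /= map_polyC /= /horner_eval hornerC.
  by move/eqP; rewrite mulf_eq0 polyC_eq0 (negPf c0) => /eqP/prim.
(* Bezout: a nonzero scalar [w] is a combination of [f] and [g]. *)
have [cofg|] := boolP (coprimep f g).
  have [[a b] /= ab1] := Bezout_coprimepP _ _ cofg.
  move: ab1; rewrite -size_poly_eq1 => /size_poly1P[w w0 ab].
  apply: (@strip_scalar w f (a * h + b * e)) => //.
  by rewrite -ab mulrDr mulrDl mulrCA mulrA [f * (b * e)]mulrCA fegh; ring.
(* The primitive part [d] of the pseudo-gcd divides both [f] and [g]. *)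
move=> ncop; exfalso.
have gcd0 : gcdp f g != 0 by rewrite gcdp_eq0 negb_and f0.
have [v v0 [d def_d primd]] := primitive_part gcd0.
have dvd_d k : gcdp f g %| k -> exists k', k = k' * d.
  case/Pdiv.Idomain.dvdpP=> [[w l] /= w0 wk].
  apply: (@strip_scalar w d (v%:P * l) k) => //.
  by rewrite (mul_polyC w) wk def_d; ring.
have [d1 fd] := dvd_d _ (dvdp_gcdl f g).
have [d2 gd] := dvd_d _ (dvdp_gcdr f g).
have [sz _] := cop d d1 d2 fd gd.
by case/negP: ncop; rewrite /coprimep def_d mul_polyC size_scale ?sz.
Qed.
End EuclidPoly.

Lemma ord2_ind (P : 'I_2 -> Prop) : P 0 -> P 1 -> forall i, P i.
Proof.
move=> P0 P1 [[|[|//]] lti]; first by rewrite (_ : Ordinal _ = 0) //; apply: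
  val_inj.
by rewrite (_ : Ordinal _ = 1) //; apply: val_inj.
Qed.

Lemma ord3_ind (P : 'I_3 -> Prop) : P 0 -> P 1 -> P 2%:R -> forall i, P i.
Proof.
move=> P0 P1 P2 [[|[|[|//]]] lti].
- by rewrite (_ : Ordinal _ = 0) //; apply: val_inj.
- by rewrite (_ : Ordinal _ = 1) //; apply: val_inj.
- by rewrite (_ : Ordinal _ = 2%:R) //; apply: val_inj.
Qed.

Lemma poly_rmorph_ext (A S : nzRingType) (f g : {rmorphism {poly A} -> S}) :
  (forall a, f a%:P = g a%:P) -> f 'X = g 'X -> f =1 g.
Proof.
move=> fgC fgX; elim/poly_ind => [|p c IHp]; first by rewrite !rmorph0.
by rewrite !rmorphD !rmorphM IHp fgX fgC.
Qed.

Lemma mpoly_rmorph_ext n (A S : nzRingType) (f g : {rmorphism {mpoly A[n]} -> S}) :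
  (forall c, f c%:MP = g c%:MP) -> (forall i, f 'X_i = g 'X_i) -> f =1 g.
Proof.
move=> fgC fgX; elim/mpolyind => [|c m p _ _ IHp]; first by rewrite !rmorph0.
rewrite !rmorphD IHp -!mul_mpolyC !rmorphM fgC; congr (_ * _ + _).
by rewrite mpolyXE_id !rmorph_prod; apply: eq_bigr => i _; rewrite !rmorphXn fgX.
Qed.

Lemma mmapXU n (A S : nzRingType) (f : {rmorphism A -> S}) (h : 'I_n -> S) i :
  mmap f h 'X_i = h i.
Proof. by rewrite mmapX mmap1U. Qed.

Section BivariateEuclid.
Variable C : closedFieldType.
Local Notation M := {mpoly C[2]}.

Definition to_poly2 : M -> {poly {poly C}} :=
  mmap (polyC \o polyC) (fun i => if i == 0 then 'X%:P else 'X).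
HB.instance Definition _ := GRing.RMorphism.on to_poly2.

Definition of_poly2 : {poly {poly C}} -> M :=
  horner_eval 'X_1 \o map_poly (horner_eval 'X_0 \o map_poly (@mpolyC 2 C)).
HB.instance Definition _ := GRing.RMorphism.on of_poly2.

Lemma to_poly2K : cancel to_poly2 of_poly2.
Proof.
apply: (@mpoly_rmorph_ext _ _ _ (of_poly2 \o to_poly2) idfun) => [c|i] /=.
  by rewrite /to_poly2 mmapC /of_poly2 /= map_polyC /= map_polyC /horner_eval
    !hornerC.
rewrite /to_poly2 mmapXU /of_poly2 /=; move: i; apply: ord2_ind => /=.
  by rewrite map_polyC /= map_polyX /horner_eval hornerC hornerX.
by rewrite map_polyX /horner_eval hornerX.
Qed.

Lemma of_poly2K : cancel of_poly2 to_poly2.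
Proof.
apply: (@poly_rmorph_ext _ _ (to_poly2 \o of_poly2) idfun) => [u|] /=.
  rewrite /of_poly2 /= map_polyC /horner_eval hornerC /=.
  pose h := to_poly2 \o horner_eval 'X_0 \o map_poly (@mpolyC 2 C).
  move: u; apply: (@poly_rmorph_ext _ _ h polyC) => [c|]; rewrite /h /=
    /horner_eval.
    by rewrite map_polyC hornerC /to_poly2 mmapC.
  by rewrite map_polyX hornerX /to_poly2 mmapXU.
by rewrite /of_poly2 /= map_polyX /horner_eval hornerX /to_poly2 mmapXU.
Qed.

Lemma mpoly_unitP (A : fieldType) n (p : {mpoly A[n]}) : p \is a GRing.unit ->
  exists2 c, c != 0 & p = c%:MP.
Proof.
by move=> /andP[/eqP def_p u]; exists p@_0%MM; rewrite // -unitfE.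
Qed.

Definition coprime2 (p q : M) :=
  forall d, mpoly_dvd d p -> mpoly_dvd d q -> d \is a GRing.unit.

Lemma euclid_mpoly2 (p q r : M) : coprime2 p q -> mpoly_dvd p (q * r) ->
  mpoly_dvd p r.
Proof.
move=> cop [e qr]; have [p0|p0] := eqVneq p 0.
  have qu : q \is a GRing.unit.
    by apply: cop; [exists 0; rewrite p0 mul0r|exists 1; rewrite mul1r].
  exists 0; rewrite mul0r; apply: (mulrI qu).
  by rewrite qr p0 !mulr0.
have [d d1 d2 pd qd|||e' re] := @euclid_poly C (to_poly2 p) (to_poly2 q)
  (to_poly2 r) (to_poly2 e).
- have : of_poly2 d \is a GRing.unit.
    apply: cop; [exists (of_poly2 d1)|exists (of_poly2 d2)].
      by rewrite -rmorphM -pd /= to_poly2K.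
    by rewrite -rmorphM -qd /= to_poly2K.
  case/mpoly_unitP => c c0 dc.
  have -> : d = c%:P%:P by rewrite -[d]of_poly2K dc /to_poly2 mmapC.
  by rewrite size_polyC polyC_eq0 c0 coefC size_polyC c0.
- by rewrite -(rmorph0 to_poly2) (inj_eq (can_inj to_poly2K)).
- by rewrite -!rmorphM qr mulrC.
by exists (of_poly2 e'); rewrite -[r]to_poly2K re rmorphM /= to_poly2K.
Qed.

End BivariateEuclid.

(** * Nonvanishing points of multivariate polynomials *)

Section Nonvanishing.
Variable C : numFieldType.

Lemma poly_nonroot (p : {poly C}) : p != 0 -> exists x, p.[x] != 0.
Proof.
move=> p0; pose s := [seq (i%:R : C) | i <- iota 0 (size p)].
have us : uniq s by rewrite map_inj_uniq ?iota_uniq // => i j /eqP; rewrite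
  Num.Theory.eqr_nat => /eqP.
have [rs|] := boolP (all (root p) s).
  by have := max_poly_roots p0 rs us; rewrite size_map size_iota ltnn.
by case/allPn=> x _ px; exists x.
Qed.

Lemma ord_widen_or_max n (i : 'I_n.+1) : i = ord_max \/ exists j, i = widen_ord
  (leqnSn n) j.
Proof.
have [lti|lei] := ltnP i n.
  by right; exists (Ordinal lti); apply: val_inj.
by left; apply: val_inj; apply/eqP; rewrite eqn_leq lei -ltnS ltn_ord.
Qed.

Lemma muni_Xmax n : muni ('X_ord_max : {mpoly C[n.+1]}) = 'X.
Proof.
rewrite /muni mmapXU; case: splitP => // j /= /eqP.
by rewrite gtn_eqF.
Qed.

Lemma muni_Xwiden n (j : 'I_n) :
  muni ('X_(widen_ord (leqnSn n) j) : {mpoly C[n.+1]}) = ('X_j)%:P.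
Proof.
rewrite /muni mmapXU; case: splitP => [k /= jk|k /= /eqP]; last by rewrite
  ltn_eqF // ltn_addr.
by congr ('X__)%:P; apply: val_inj.
Qed.

Lemma muniK n : cancel (@muni n C) (horner_eval 'X_ord_max \o map_poly (@mwiden n
  C)).
Proof.
apply: (@mpoly_rmorph_ext _ _ _ (horner_eval 'X_ord_max \o map_poly (@mwiden n C)
  \o @muni n C) idfun) => [c|i] /=.
  by rewrite muniC map_polyC /= mwidenC /horner_eval hornerC.
have [->|[j ->]] := ord_widen_or_max i; first by rewrite muni_Xmax map_polyX
  /horner_eval hornerX.
rewrite muni_Xwiden map_polyC /= /mwiden mmapXU /horner_eval hornerC.
by congr ('X__); apply: val_inj.
Qed.

Lemma meval_muni n (p : {mpoly C[n.+1]}) (v : 'I_n -> C) t :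
  (map_poly (meval v) (muni p)).[t] = p.@[fun i => oapp v t (unlift ord_max i)].
Proof.
set w := fun i => oapp v t (unlift ord_max i); move: p.
apply: (@mpoly_rmorph_ext _ _ _ (horner_eval t \o map_poly (meval v) \o @muni n
  C) (meval w)) => [c|i] /=.
  by rewrite muniC map_polyC /= !mevalC /horner_eval hornerC.
rewrite mevalXU; have [->|[j ->]] := ord_widen_or_max i.
  by rewrite muni_Xmax map_polyX /horner_eval hornerX /w unlift_none.
rewrite muni_Xwiden map_polyC /= mevalXU /horner_eval hornerC /w.
have -> : widen_ord (leqnSn n) j = lift ord_max j by apply: val_inj; rewrite /=
  /bump leqNgt ltn_ord.
by rewrite liftK.
Qed.

(** Induction on the number of variables: specialize all but the last one so
    that the leading coefficient in the last one survives. *)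
Lemma mpoly_nonvanishing n (p : {mpoly C[n]}) : p != 0 -> exists v, p.@[v] != 0.
Proof.
elim: n p => [|n IHn] p p0.
  have def_p : p = (p@_0)%:MP.
    apply/mpolyP=> m; rewrite mcoeffC (_ : m = 0%MM) ?eqxx ?mulr1 //.
    by apply/mnmP=> -[].
  exists (fun=> 0); apply: contraNneq p0; rewrite {1}def_p mevalC => p00.
  by rewrite def_p p00 mpolyC0.
have mp0 : muni p != 0 by rewrite -(rmorph0 (@muni n C)) (inj_eq (can_inj (@muniK
  n))).
have [|v lv] := IHn (lead_coef (muni p)); first by rewrite lead_coef_eq0.
have [|t tv] := @poly_nonroot (map_poly (meval v) (muni p)).
  apply: contraNneq lv => /polyP/(_ (size (muni p)).-1).
  by rewrite coef_map coef0 => /eqP.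
by exists (fun i => oapp v t (unlift ord_max i)); rewrite -meval_muni.
Qed.

Lemma dhomog_meval n d (p : {mpoly C[n]}) (k : C) (v : 'I_n -> C) :
  p \is d.-homog -> p.@[fun i => k * v i] = k ^+ d * p.@[v].
Proof.
move=> /dhomogP hp; rewrite !mevalE mulr_sumr !big_seq; apply: eq_bigr => m /hp <-.
rewrite mulrCA; congr (_ * _).
by rewrite /= mdegE -prodrXr -big_split; apply: eq_bigr => i _; rewrite exprMn.
Qed.

End Nonvanishing.

(** * From homogeneous 1-forms to the affine chart *)

Lemma mdeg2 (m : 'X_{1..2}) : mdeg m = (m 0%R + m 1%R)%N.
Proof.
rewrite mdegE !big_ord_recl big_ord0 addn0; congr (_ + m _)%N.
exact: val_inj.
Qed.

Section Chart.
Variable C : numClosedFieldType.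
Local Notation M2 := {mpoly C[2]}.
Local Notation M3 := {mpoly C[3]}.
HB.instance Definition _ := GRing.RMorphism.copy (@chart C)
  (comp_mpoly ([tuple 'X_0; 'X_1; 1] : 3.-tuple M2)).

Lemma chartX0 : chart ('X_0 : M3) = 'X_0.
Proof. by rewrite /chart comp_mpolyXU. Qed.
Lemma chartX1 : chart ('X_1 : M3) = 'X_1.
Proof. by rewrite /chart comp_mpolyXU. Qed.
Lemma chartX2 : chart ('X_2%:R : M3) = 1.
Proof. by rewrite /chart comp_mpolyXU. Qed.

Definition pt3 (x y z : C) : 'I_3 -> C := fun i => nth 0 [:: x; y; z] i.

Lemma meval_chart (p : M3) (u : 'I_2 -> C) : (chart p).@[u] = p.@[pt3 (u 0) (u 1)
  1].
Proof.
rewrite /chart comp_mpoly_meval; apply: meval_eq; apply: ord3_ind.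
- by rewrite (tnth_nth 0) /= mevalXU.
- by rewrite (tnth_nth 0) /= mevalXU.
- by rewrite (tnth_nth 0) /= meval1.
Qed.

(** A homogeneous polynomial is determined by its values off the line
    [z_2 = 0], and there homogeneity reduces to [z_2 = 1]. *)
Lemma chart_inj d (p q : M3) : p \is d.-homog -> q \is d.-homog -> chart p =
  chart q -> p = q.
Proof.
move=> hp hq pq; apply/eqP; rewrite -subr_eq0; apply/negPn/negP=> pq0.
have hpq : p - q \is d.-homog by rewrite rpredB.
have [|v] := @mpoly_nonvanishing C 3 ((p - q) * 'X_2%:R).
  apply: mulf_neq0 pq0 _; apply/eqP=> /(congr1 (fun p => p.@[fun=> 1])).
  by rewrite mevalXU meval0; apply/eqP/oner_neq0.
rewrite mevalM mevalXU mulf_eq0 => /norP[/eqP pqv v2]; case: pqv.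
rewrite -(@meval_eq _ _ (fun i => v 2%:R * pt3 (v 0 / v 2%:R) (v 1 / v 2%:R) 1 i)).
  rewrite (dhomog_meval _ _ hpq).
  have := meval_chart (p - q) (fun i => nth 0 [:: v 0 / v 2%:R; v 1 / v 2%:R] i).
  by rewrite /= => <-; rewrite rmorphB /= pq subrr meval0 mulr0.
by apply: ord3_ind; rewrite /pt3 /= ?mulr1 // mulrCA divff // mulr1.
Qed.

Lemma homogenization (p : M2) d : (msize p <= d.+1)%N ->
  exists2 P : M3, P \is d.-homog & chart P = p.
Proof.
move=> pd; pose h (m : 'X_{1..2}) : 'X_{1..3} := Multinom [tuple m 0; m 1; (d -
  mdeg m)%N].
exists (\sum_(m <- msupp p) p@_m *: 'X_[h m]).
  rewrite big_seq; apply: rpred_sum => m mp; apply: rpredZ; rewrite dhomogX /=.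
  have lemd : (mdeg m <= d)%N by rewrite -ltnS (leq_trans (msize_mdeg_lt mp)).
  rewrite mdegE !big_ord_recl big_ord0 /= !multinomE !(tnth_nth 0%N) /= addn0.
  by rewrite addnA -mdeg2 subnKC.
rewrite rmorph_sum /= [RHS]mpolyE; apply: eq_bigr => m _.
rewrite /chart comp_mpolyZ comp_mpolyX; congr (_ *: _).
rewrite [RHS]mpolyXE_id !big_ord_recl !big_ord0 !(tnth_nth 0) /= !multinomE
  !(tnth_nth 0%N) /=.
rewrite expr1n !mulr1 (_ : lift _ _ = 1) //; exact: val_inj.
Qed.

Lemma msize_chart (p : M3) d : p \is d.-homog -> (msize (chart p) <= d.+1)%N.
Proof.
move=> /dhomogP hp; rewrite /chart comp_mpolyE big_seq.
elim/big_ind: _ => [|q r hq hr|m /hp /= md]; first by rewrite msize0.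
  by apply: leq_trans (msizeD_le q r) _; rewrite geq_max hq hr.
apply: leq_trans (msizeZ_le _ _) _.
rewrite !big_ord_recl !big_ord0 !(tnth_nth 0) /= expr1n !mulr1.
rewrite -[_ * _](_ : 'X_[U_(0) *+ m 0 + U_(1) *+ m 1] = _); last first.
  by rewrite mpolyXD !mpolyXn; congr (_ * 'X_[_ *+ m _]); apply: val_inj.
rewrite msizeX ltnS -md mdegD !mdegMn !mdeg1 !mul1n.
rewrite mdegE !big_ord_recl (_ : lift ord0 ord0 = 1); last exact: val_inj.
by rewrite addnA leq_addr.
Qed.

Section Saturation.
Variable F : foliation C.
Local Notation w := (fol_form F).

Lemma fol_form_neq0 : ~ (forall i, w i = 0).
Proof.
move=> w0; have /(_ 0) := @fol_saturated _ F; rewrite unitr0 => H.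
suff: false by []; apply: H => i; exists 0; by rewrite w0 mulr0.
Qed.

Lemma fol_radial3 : 'X_0 * w 0 + 'X_1 * w 1 + 'X_2%:R * w 2%:R = 0.
Proof.
have := fol_radial F; rewrite !big_ord_recl big_ord0 addr0 addrA => <-.
by congr (_ + 'X__ * w _ + 'X__ * w _); apply: val_inj.
Qed.

(** The homogenization of [k] times the homogenization of [Y i] in the
    complementary degree has the same chart as the i-th coefficient of the form,
    hence equals it; so it is a common factor of a saturated form. *)
Lemma chart_common_factor_unit (k : M2) (Y : 'I_3 -> M2) :
  (forall i, chart (w i) = k * Y i) -> k \is a GRing.unit.
Proof.
move=> wY; have k0 : k != 0.
  apply/eqP=> k0; apply: fol_form_neq0 => i.
  by apply: (chart_inj (fol_homog F i) (rpred0 _)); rewrite wY k0 mul0r rmorph0.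
(* [K] has the exact degree of [k], so that the degree left for the cofactors
   is the one given by [msizeM]. *)
have szk := mpolySpred _ k0.
have [K hK chK] : exists2 K : M3, K \is (msize k).-1.-homog & chart K = k.
  by apply: homogenization; rewrite -szk.
have Ku : K \is a GRing.unit.
  apply: (@fol_saturated _ F) => i; have [Y0|Y0] := eqVneq (Y i) 0.
    exists 0; rewrite mul0r; apply: (chart_inj (fol_homog F i) (rpred0 _)).
    by rewrite wY Y0 mulr0 rmorph0.
  have := msize_chart (fol_homog F i); rewrite wY msizeM // szk (mpolySpred _ Y0)
    addSn addnS /= ltnS.
  move=> le_e.
  have [L hL chL] : exists2 L : M3, L \is (fol_exp F - (msize k).-1).-homog &
    chart L = Y i.
    by apply: homogenization; rewrite (mpolySpred _ Y0) ltnS leq_subRL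
      ?(leq_trans _ le_e) ?leq_addr.
  exists L; apply: (chart_inj (fol_homog F i)).
    rewrite -[fol_exp F](@subnK (msize k).-1) ?(leq_trans _ le_e) ?leq_addr //.
    exact: dhomogM.
  by rewrite rmorphM /= chL chK wY mulrC.
have [c c0 Kc] := mpoly_unitP Ku.
by rewrite -chK Kc /chart comp_mpolyC rmorph_unit // unitfE.
Qed.

(** Both [(w_1, - w_0)] and [X] span the kernel of the form on the chart, and
    [X] is primitive, so the former is a polynomial multiple [k X]; by the
    radial relation [k] divides the third coefficient of the form as well. *)
Lemma fol_chart (X : 'I_2 -> M2) : no_common_factor X -> defined_by F X ->
  exists2 k : C, k != 0 & chart (w 0) = - (k%:MP * X 1) /\ chart (w 1) = k%:MP *
    X 0.
Proof.
move=> hX hF.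
have cop10 : coprime2 (X 1) (X 0).
  by move=> d d1 d0; apply: hX; apply: ord2_ind.
have [u Au] : mpoly_dvd (X 1) (chart (w 0)).
  apply: (euclid_mpoly2 cop10); exists (- chart (w 1)).
  by apply/eqP; rewrite mulNr -addr_eq0 mulrC; apply/eqP.
have [k Ak Bk] : exists2 k, chart (w 0) = - (k * X 1) & chart (w 1) = k * X 0.
  have [X10|X10] := eqVneq (X 1) 0.
    have X0u : X 0 \is a GRing.unit.
      by apply: cop10; [exists 0; rewrite X10 mul0r|exists 1; rewrite mul1r].
    exists (chart (w 1) / X 0); last by rewrite divrK.
    by rewrite Au X10 !mulr0 oppr0.
  exists (- u); first by rewrite Au mulNr opprK.
  apply: (mulIf X10); move: hF; rewrite /defined_by Au => hF.
  by apply/eqP; rewrite -subr_eq0 -{1}hF; apply/eqP; ring.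
have Ck : chart (w 2%:R) = k * ('X_0 * X 1 - 'X_1 * X 0).
  have := congr1 (@chart C) fol_radial3.
  rewrite !rmorphD !rmorphM rmorph0 /= chartX0 chartX1 chartX2 mul1r Ak Bk => H.
  by apply/eqP; rewrite -subr_eq0 -{1}H; apply/eqP; ring.
have : k \is a GRing.unit.
  apply: (@chart_common_factor_unit k (fun i => nth 0 [:: - X 1; X 0; 'X_0 * X 1
    - 'X_1 * X 0] i)).
  by apply: ord3_ind; rewrite //= mulrN.
by case/mpoly_unitP => c c0 kc; exists c; rewrite // -kc.
Qed.
End Saturation.
End Chart.

(** * Generic lines *)

Section LineAtInfinity.
Variable C : numClosedFieldType.
Local Notation M2 := {mpoly C[2]}.
Local Notation M3 := {mpoly C[3]}.

(** The points [(1, a, 0)] are dense in the line [z_2 = 0], so the term of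
    degree 0 in the last variable vanishes. *)
Lemma dvd_X2 d (p : M3) : p \is d.-homog ->
  (forall a, p.@[pt3 1 a 0] = 0) -> mpoly_dvd 'X_2%:R p.
Proof.
move=> hp pa; have c0 : (muni p)`_0 = 0.
  apply/eqP/negPn/negP => c0.
  have [|v] := @mpoly_nonvanishing C 2 ((muni p)`_0 * 'X_0).
    apply: mulf_neq0 c0 _; apply/eqP=> /(congr1 (fun p => p.@[fun=> 1])).
    by rewrite mevalXU meval0; apply/eqP/oner_neq0.
  rewrite mevalM mevalXU mulf_eq0 => /norP[/eqP pv v0]; case: pv.
  rewrite -[LHS]/(meval v _) -coef_map -horner_coef0 meval_muni.
  transitivity (p.@[fun i => v 0 * pt3 1 (v 1 / v 0) 0 i]).
    apply: meval_eq; apply: ord3_ind; rewrite /pt3 /=.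
    - have -> : (0 : 'I_3) = lift ord_max (0 : 'I_2) by apply: val_inj.
      by rewrite liftK /= mulr1.
    - have -> : (1 : 'I_3) = lift ord_max (1 : 'I_2) by apply: val_inj.
      by rewrite liftK /= mulrC divfK.
    - have -> : (2%:R : 'I_3) = ord_max by apply: val_inj.
      by rewrite unlift_none mulr0.
  by rewrite (dhomog_meval _ _ hp) pa mulr0.
exists (horner_eval 'X_ord_max (map_poly (@mwiden 2 C) (drop_poly 1 (muni p)))).
rewrite -{1}[p]muniK /= -[muni p in LHS](poly_take_drop 1).
have -> : take_poly 1 (muni p) = 0.
  by apply/polyP=> -[|i]; rewrite coef_take_poly coef0.
rewrite add0r rmorphM /= map_polyX /horner_eval hornerM hornerX.
by congr (_ * 'X__); apply: val_inj.
Qed.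

(** The value of the form at the point at infinity [(1, p, 0)] of the line
    [y = p x + q], on the second point [(0, q, 1)] of that line: it vanishes
    exactly when the line is tangent to the foliation at infinity. *)
Definition infinity_poly (F : foliation C) : M2 :=
  let w i := fol_form F i \mPo [tuple 1; 'X_0; 0] in 'X_1 * w 1 + w 2%:R.

Lemma meval_infinity (F : foliation C) (v : 'I_2 -> C) :
  (infinity_poly F).@[v] =
  v 1 * (fol_form F 1).@[pt3 1 (v 0) 0] + (fol_form F 2%:R).@[pt3 1 (v 0) 0].
Proof.
have E (p : M3) : (p \mPo [tuple 1; 'X_0; 0] : M2).@[v] = p.@[pt3 1 (v 0) 0].
  rewrite comp_mpoly_meval; apply: meval_eq; apply: ord3_ind; rewrite (tnth_nth
    0) /=.
  - exact: meval1.
  - exact: mevalXU.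
  - exact: meval0.
by rewrite mevalD mevalM mevalXU !E.
Qed.

(** It is affine in [q], so both of its coefficients would vanish, and by the
    radial relation the whole form would vanish along the line at infinity,
    against saturation. *)
Lemma infinity_poly_neq0 (F : foliation C) : infinity_poly F != 0.
Proof.
apply/eqP=> h0; pose w i a := (fol_form F i).@[pt3 1 a 0].
have H a b : b * w 1 a + w 2%:R a = 0.
  have := meval_infinity F (fun i => nth 0 [:: a; b] i).
  by rewrite h0 meval0 /= => <-.
have w2 a : w 2%:R a = 0 by have := H a 0; rewrite mul0r add0r.
have w1 a : w 1 a = 0 by have := H a 1; rewrite mul1r w2 addr0.
have w0 a : w 0 a = 0.
  have := congr1 (meval (pt3 1 a 0)) (fol_radial3 F).
  rewrite !mevalD !mevalM !mevalXU meval0 -/(w 0 a) -/(w 1 a) -/(w 2%:R a).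
  by rewrite w1 w2 /pt3 /= mul1r !mulr0 !addr0.
have : ('X_2%:R : M3) \is a GRing.unit.
  apply: (@fol_saturated _ F); apply: ord3_ind;
    by apply: (dvd_X2 (fol_homog F _)).
case/mpoly_unitP=> c c0 /(congr1 (meval (fun=> 0))).
by rewrite mevalXU mevalC => c00; rewrite -c00 eqxx in c0.
Qed.

(** Generic lines may be taken of the form [p x - y + q = 0]. *)
Lemma dehomog_neq0 d (g : M3) : g != 0 -> g \is d.-homog ->
  g \mPo [tuple 'X_0; -1; 'X_1] != 0 :> M2.
Proof.
move=> g0 hg; apply/eqP=> g'0.
have [|v] := @mpoly_nonvanishing C 3 (g * 'X_1).
  apply: mulf_neq0 g0 _; apply/eqP=> /(congr1 (fun p => p.@[fun=> 1])).
  by rewrite mevalXU meval0; apply/eqP/oner_neq0.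
rewrite mevalM mevalXU mulf_eq0 => /norP[/eqP gv v1]; case: gv.
rewrite -(@meval_eq _ _ (fun i => - v 1 * pt3 (- (v 0 / v 1)) (-1) (- (v 2%:R / v
  1)) i)).
  rewrite (dhomog_meval _ _ hg).
  pose u := fun i : 'I_2 => nth 0 [:: - (v 0 / v 1); - (v 2%:R / v 1)] i.
  have := congr1 (meval u) g'0; rewrite comp_mpoly_meval.
  rewrite meval0 => g'v; apply/eqP; rewrite mulf_eq0; apply/orP; right.
  rewrite -g'v; apply/eqP/meval_eq; apply: ord3_ind; rewrite (tnth_nth 0) /pt3 /=.
  - by rewrite mevalXU.
  - by rewrite mevalN meval1.
  - by rewrite mevalXU.
by apply: ord3_ind; rewrite /pt3 /= mulrNN ?mulr1 // mulrCA divff // mulr1.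
Qed.
End LineAtInfinity.

(** * The tangency polynomial *)

Section Lines.
Variable C : numClosedFieldType.
Local Notation M := {mpoly C[2]}.
Local Notation "x %:F" := (tofrac x) : ring_scope.

(** For [c = 1], restriction of a polynomial in [(x, y)] to the line
    [y = q + p x]; the result is a polynomial in [x] with coefficients in
    [(p, q)].  For [c = -1] the same formula expresses [(p, q)] through
    [(x, y)], with [p] as the variable. *)
Definition on_lines (c : C) : M -> {poly M} :=
  mmap (polyC \o @mpolyC 2 C)
    (fun j => if j == 0 then 'X else ('X_1)%:P + (c%:MP * 'X_0)%:P * 'X).
HB.instance Definition _ c := GRing.RMorphism.on (on_lines c).

(** The change of coordinates from [C[x, y][p]] to [C[p, q][x]] for [c = 1], and
    its inverse for [c = -1]. *)
Definition swap_lines (c : C) : {poly M} -> {poly M} :=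
  horner_eval ('X_0)%:P \o map_poly (on_lines c).
HB.instance Definition _ c := GRing.RMorphism.on (swap_lines c).

Lemma on_linesC c a : on_lines c a%:MP = a%:MP%:P.
Proof. by rewrite /on_lines mmapC. Qed.
Lemma on_linesX0 c : on_lines c 'X_0 = 'X.
Proof. by rewrite /on_lines mmapXU. Qed.
Lemma on_linesX1 c : on_lines c 'X_1 = ('X_1)%:P + (c%:MP * 'X_0)%:P * 'X.
Proof. by rewrite /on_lines mmapXU. Qed.

Lemma swap_linesC c p : swap_lines c p%:P = on_lines c p.
Proof. by rewrite /swap_lines /= map_polyC /horner_eval hornerC. Qed.
Lemma swap_linesX c : swap_lines c 'X = ('X_0)%:P.
Proof. by rewrite /swap_lines /= map_polyX /horner_eval hornerX. Qed.

Lemma swap_linesK c : cancel (swap_lines c) (swap_lines (- c)).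
Proof.
apply: (@poly_rmorph_ext _ _ (swap_lines (- c) \o swap_lines c) idfun) => [p|]
  /=; last first.
  by rewrite swap_linesX swap_linesC on_linesX0.
rewrite swap_linesC; move: p.
apply: (@mpoly_rmorph_ext _ _ _ (swap_lines (- c) \o on_lines c) polyC) => [a|] /=.
  by rewrite on_linesC swap_linesC on_linesC.
apply: ord2_ind; first by rewrite on_linesX0 swap_linesX.
rewrite on_linesX1 rmorphD rmorphM /= swap_linesX !swap_linesC rmorphM /=.
by rewrite on_linesX1 on_linesX0 on_linesC rmorphN !polyCM; ring.
Qed.

Lemma horner_on_lines (S : comNzRingType) (g : {rmorphism M -> S}) z p :
  (map_poly g (on_lines 1 p)).[z] =
  mmap (g \o @mpolyC 2 C) (fun j => if j == 0 then z else g 'X_1 + g 'X_0 * z) p.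
Proof.
move: p; pose T := mmap (g \o @mpolyC 2 C) (fun j : 'I_2 => if j == 0 then z else
  g 'X_1 + g 'X_0 * z).
apply: (@mpoly_rmorph_ext _ _ _ (horner_eval z \o map_poly g \o on_lines 1) T) =>
  [c|] /=.
  by rewrite on_linesC map_polyC /horner_eval hornerC /T mmapC.
apply: ord2_ind; rewrite /T mmapXU /=.
  by rewrite on_linesX0 map_polyX /horner_eval hornerX.
by rewrite on_linesX1 mpolyC1 mul1r rmorphD rmorphM /= !map_polyC map_polyX
  /horner_eval !hornerE.
Qed.

Variable X : 'I_2 -> M.

Definition tangency_poly : {poly M} :=
  swap_lines 1 ('X * (X 0)%:P - (X 1)%:P).

Lemma tangency_polyE :
  tangency_poly = ('X_0)%:P * on_lines 1 (X 0) - on_lines 1 (X 1).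
Proof. by rewrite /tangency_poly rmorphB rmorphM /= swap_linesX !swap_linesC. Qed.

Lemma meval_tangency (v : 'I_2 -> C) x :
  let u := fun j : 'I_2 => if j == 0 then x else v 1 + v 0 * x in
  (map_poly (meval v) tangency_poly).[x] = v 0 * (X 0).@[u] - (X 1).@[u].
Proof.
pose h : {rmorphism {poly M} -> C} := horner_eval x \o map_poly (meval v).
have E p : h (on_lines 1 p) = p.@[fun j : 'I_2 => if j == 0 then x else v 1 + v 0
  * x].
  rewrite /h /= /horner_eval (horner_on_lines (meval v)).
  pose T := mmap (meval v \o @mpolyC 2 C) (fun j : 'I_2 => if j == 0 then x else
    (meval v) 'X_1 + (meval v) 'X_0 * x).
  apply: (@mpoly_rmorph_ext _ _ _ T (meval _)) => [c|j]; rewrite /T /=.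
    by rewrite mmapC /= !mevalC.
  by rewrite mmapXU !mevalXU /=.
rewrite /= -!E; transitivity (h tangency_poly); first by [].
rewrite tangency_polyE rmorphB rmorphM; congr (_ * _ - _).
by rewrite /h /= map_polyC /horner_eval hornerC /= mevalXU.
Qed.

Lemma pairingE (l v : 'rV[C]_3) :
  pairing l v = l 0 0 * v 0 0 + l 0 1 * v 0 1 + l 0 2%:R * v 0 2%:R.
Proof.
rewrite /pairing !big_ord_recl big_ord0 addr0 addrA.
by congr (_ + l _ _ * v _ _ + l _ _ * v _ _); apply: val_inj.
Qed.

Definition pt (x y z : C) : 'rV[C]_3 := \row_i pt3 x y z i.

Lemma form_at_pt (F : foliation C) x y z i :
  form_at F (pt x y z) 0 i = (fol_form F i).@[pt3 x y z].
Proof. by rewrite mxE; apply: meval_eq => j; rewrite mxE. Qed.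

Lemma form_at_scale (F : foliation C) (c : C) (q : 'rV_3) :
  form_at F (c *: q) = c ^+ fol_exp F *: form_at F q.
Proof.
apply/rowP=> i; rewrite !mxE -(dhomog_meval _ _ (fol_homog F i)).
by apply: meval_eq => j; rewrite mxE.
Qed.

Lemma pairing_scale (c : C) (l v : 'rV_3) : pairing (c *: l) v = c * pairing l v.
Proof. by rewrite !pairingE !mxE; ring. Qed.

Lemma form_at_radial (F : foliation C) (q : 'rV_3) : pairing (form_at F q) q = 0.
Proof.
rewrite pairingE !mxE; have := congr1 (meval (q 0)) (fol_radial3 F).
by rewrite !mevalD !mevalM !mevalXU meval0 => <-; rewrite ![_ * q _ _]mulrC.
Qed.

Section Tangencies.
Variables (F : foliation C) (k : C).
Hypotheses (k0 : k != 0) (wA : chart (fol_form F 0) = - (k%:MP * X 1))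
  (wB : chart (fol_form F 1) = k%:MP * X 0).
Variable v : 'I_2 -> C.
Local Notation a := (v 0).
Local Notation b := (v 1).
Local Notation l := (pt (v 0) (-1) (v 1)).
Local Notation f := (map_poly (meval v) tangency_poly).

(** [(1, p, 0)] is the direction of the line. *)
Lemma form_at_line x :
  pairing (form_at F (pt x (b + a * x) 1)) (pt 1 a 0) = k * f.[x].
Proof.
rewrite pairingE !form_at_pt !mxE /pt3 /= mulr1 mulr0 addr0 meval_tangency.
set u := fun j : 'I_2 => _.
have E i : (fol_form F i).@[pt3 x (b + a * x) 1] = (chart (fol_form F i)).@[u].
  by rewrite meval_chart.
by rewrite !E wA wB mevalN !mevalM !mevalC; ring.
Qed.

(** The line is spanned by the point itself, on which the form vanishes by the
    radial relation, and by the direction. *)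
Lemma tangency_affine x : tangency_point F l (pt x (b + a * x) 1) <-> f.[x] = 0.
Proof.
split=> [[_ _ /(_ (pt 1 a 0))]|fx].
  rewrite form_at_line pairingE !mxE /pt3 /= => H; apply: (mulfI k0).
  by rewrite mulr0; apply: H; ring.
split.
- apply/eqP=> /rowP/(_ 2%:R); rewrite !mxE /pt3 /=; exact/eqP/oner_neq0.
- by rewrite pairingE !mxE /pt3 /=; ring.
move=> q; rewrite pairingE !mxE /pt3 /= => lq.
have := form_at_radial F (pt x (b + a * x) 1); have := form_at_line x.
rewrite fx mulr0; move: (form_at F _) => w.
rewrite !pairingE !mxE /pt3 /= => H1 H2.
(* Decomposition of [q] along the point [(x, b + a x, 1)] and the direction. *)
transitivity (q 0 2%:R * (w 0 0 * x + w 0 1 * (b + a * x) + w 0 2%:R * 1)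
  + (q 0 0 - q 0 2%:R * x) * (w 0 0 * 1 + w 0 1 * a + w 0 2%:R * 0)
  - w 0 1 * (a * q 0 0 + -1 * q 0 1 + b * q 0 2%:R)); first by ring.
by rewrite H1 H2 lq; ring.
Qed.

Lemma tangency_shape q : (infinity_poly F).@[v] != 0 -> tangency_point F l q ->
  q 0 2%:R != 0 /\ q = q 0 2%:R *: pt (q 0 0 / q 0 2%:R) (b + a * (q 0 0 / q 0
    2%:R)) 1.
Proof.
move=> inf0 [q0 lq tq].
have lq' : q 0 1 = a * q 0 0 + b * q 0 2%:R.
  apply/eqP; rewrite -subr_eq0 -oppr_eq0; move/eqP: lq; rewrite pairingE !mxE
    /pt3 /=.
  by congr (_ == _); ring.
have q2 : q 0 2%:R != 0.
  apply: contraNneq inf0 => q20.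
  have q0E : q = q 0 0 *: pt 1 a 0.
    apply/rowP; apply: ord3_ind; rewrite !mxE /pt3 /= ?mulr1 ?mulr0 //.
    by rewrite lq' q20 mulr0 addr0 mulrC.
  have q00 : q 0 0 != 0 by apply: contraNneq q0 => q00; rewrite q0E q00 scale0r.
  have := tq (pt 0 b 1); rewrite pairingE !mxE /pt3 /= => /(_ ltac:(ring)).
  rewrite q0E form_at_scale pairing_scale pairingE !form_at_pt !mxE /pt3 /= => /eqP.
  rewrite mulf_eq0 expf_eq0 (negPf q00) andbF /= mulr0 add0r mulr1 => /eqP H.
  by rewrite meval_infinity mulrC H.
split=> //; apply/rowP; apply: ord3_ind; rewrite !mxE /pt3 /= ?mulr1 //.
  by rewrite mulrC divfK.
rewrite lq'; field; exact: q2.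
Qed.

Lemma tangency_scale (c : C) q : c != 0 -> tangency_point F l (c *: q) ->
  tangency_point F l q.
Proof.
move=> c0 [cq lq tq]; split.
- by apply: contraNneq cq => ->; rewrite scaler0.
- apply: (mulfI c0); rewrite mulr0 -[RHS]lq !pairingE !mxE; ring.
move=> u /tq; rewrite form_at_scale pairing_scale => /eqP.
by rewrite mulf_eq0 expf_eq0 (negPf c0) andbF => /eqP.
Qed.

End Tangencies.

(** The polynomial [D] lets further open conditions be imposed on the line. *)
Lemma generic_tangencies (F : foliation C) d :
  has_degree F d -> no_common_factor X -> defined_by F X ->
  forall D : M, D != 0 -> exists v, D.@[v] != 0 /\
    exists s : seq C, [/\ size s = d, uniq s &
      forall x, (x \in s) = root (map_poly (meval v) tangency_poly) x].
Proof.
move=> [e [g [g0 hg tan]]] hX hF D D0.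
have [k k0 [wA wB]] := fol_chart hX hF.
have [|v] := @mpoly_nonvanishing C 2 (D * (g \mPo [tuple 'X_0; -1; 'X_1]) *
  infinity_poly F).
  by rewrite !mulf_neq0 ?(dehomog_neq0 g0 hg) ?infinity_poly_neq0.
rewrite !mevalM !mulf_eq0 !negb_or => /andP[/andP[Dv gv] iv].
exists v; split=> //; set l := pt (v 0) (-1) (v 1).
have l0 : l != 0.
  apply/eqP=> /rowP/(_ 1); rewrite !mxE /pt3 /= => /eqP.
  by rewrite oppr_eq0 oner_eq0.
have [|p [ptan pinj psurj]] := tan l l0.
  rewrite comp_mpoly_meval in gv; rewrite -(@meval_eq _ _ (fun i => (tnth [tuple
    'X_0; -1; 'X_1] i).@[v])) //.
  by apply: ord3_ind; rewrite (tnth_nth 0) mxE /pt3 /= ?mevalXU // mevalN meval1.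
pose x i := p i 0 0 / p i 0 2%:R.
have shape i : p i 0 2%:R != 0 /\ p i = p i 0 2%:R *: pt (x i) (v 1 + v 0 * x i) 1.
  exact: (tangency_shape iv (ptan i)).
exists [seq x i | i <- enum 'I_d]; split.
- by rewrite size_map size_enum_ord.
- rewrite map_inj_uniq ?enum_uniq // => i j xij; apply: pinj.
  have [pi2 pi] := shape i; have [pj2 pj] := shape j.
  exists (p i 0 2%:R / p j 0 2%:R); first by rewrite mulf_neq0 ?invr_eq0.
  by rewrite {1}pi {2}pj scalerA divfK // xij.
move=> z; apply/mapP/rootP => [[i _ ->]|fz].
  apply/(tangency_affine k0 wA wB); have [pi2 pi] := shape i.
  by apply: (tangency_scale pi2); rewrite -pi.
have /(psurj _)[i [c c0 zi]] : tangency_point F l (pt z (v 1 + v 0 * z) 1).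
  exact/(tangency_affine k0 wA wB).
exists i; first by rewrite mem_enum.
have := congr1 (fun r : 'rV_3 => r 0 0) zi; have := congr1 (fun r : 'rV_3 => r 0
  2%:R) zi.
rewrite /x !mxE /pt3 /= => E1 ->.
have [pi2 _] := shape i.
by apply: (mulIf pi2); rewrite divfK // mulrAC -E1 mul1r.
Qed.

End Lines.

(** * The tangent line at the generic point *)

Lemma tofrac_inj (A : idomainType) : injective (@tofrac A).
Proof. by move=> p q /eqP; rewrite tofrac_eq => /eqP. Qed.

(** Evaluating at the generic point only takes an embedding of [C[x, y]] into a
    field [K]; leaving [K] abstract keeps the construction of fractions out of
    the computations. *)
Section Kernel.
Variable C : numClosedFieldType.
Local Notation M := {mpoly C[2]}.
Variables (K : fieldType) (iota : {rmorphism M -> K}).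
Hypothesis iota_inj : injective iota.
Local Notation "x %:F" := (iota x) : ring_scope.
Variable X : 'I_2 -> M.
Implicit Types V : {poly M}.
Hypotheses (copX : coprime2 (X 0) (X 1)) (X0 : X 0 != 0).
Local Notation tan := (tangency_poly X).

Lemma iota_eq0 p : (p%:F == 0) = (p == 0).
Proof. by rewrite -(rmorph0 iota) (inj_eq iota_inj). Qed.

Definition slope : K := (X 1)%:F / (X 0)%:F.

(** Coordinates [(p, q)] of the tangent line at the generic point [(x, y)]. *)
Definition tangent_line : M -> K :=
  mmap (iota \o @mpolyC 2 C)
    (fun j => if j == 0 then slope else ('X_1)%:F - slope * ('X_0)%:F).
HB.instance Definition _ := GRing.RMorphism.on tangent_line.

Lemma tangent_lineC c : tangent_line c%:MP = (c%:MP)%:F.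
Proof. by rewrite /tangent_line mmapC. Qed.
Lemma tangent_lineX0 : tangent_line 'X_0 = slope.
Proof. by rewrite /tangent_line mmapXU. Qed.
Lemma tangent_lineX1 : tangent_line 'X_1 = ('X_1)%:F - slope * ('X_0)%:F.
Proof. by rewrite /tangent_line mmapXU. Qed.

Definition tangent_eval : {poly M} -> K :=
  horner_eval ('X_0)%:F \o map_poly tangent_line.
HB.instance Definition _ := GRing.RMorphism.on tangent_eval.

Lemma tangent_evalC p : tangent_eval p%:P = tangent_line p.
Proof. by rewrite /tangent_eval /= map_polyC /horner_eval hornerC. Qed.

Lemma tangent_evalE V :
  tangent_eval V = (map_poly iota (swap_lines (-1) V)).[slope].
Proof.
move: V; pose T := horner_eval slope \o map_poly iota \o swap_lines (-1 : C).
apply: (@poly_rmorph_ext _ _ tangent_eval T) => [p|]; last first.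
  rewrite /T /= swap_linesX /tangent_eval /= map_polyX map_polyC.
  by rewrite /horner_eval hornerX hornerC.
rewrite /= tangent_evalC /T /= swap_linesC; move: p.
pose T' := horner_eval slope \o map_poly iota \o on_lines (-1 : C).
apply: (@mpoly_rmorph_ext _ _ _ tangent_line T') => [c|] /=; rewrite /T' /=.
  by rewrite tangent_lineC on_linesC map_polyC /horner_eval hornerC.
apply: ord2_ind.
  by rewrite tangent_lineX0 on_linesX0 map_polyX /horner_eval hornerX.
rewrite tangent_lineX1 on_linesX1 mpolyCN mpolyC1 mulN1r rmorphD rmorphM /=
  !map_polyC map_polyX /=.
by rewrite /horner_eval hornerD hornerM hornerX !hornerC rmorphN /= mulNr [slope
  * _]mulrC.
Qed.

(** Gauss's lemma for a linear divisor: modulo [X_0] the divisor is [- X_1], a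
    non-zero-divisor there by coprimality, so [X_0] divides the quotient. *)
Lemma dvd_linear_strip n (W G : {poly M}) (L := 'X * (X 0)%:P - (X 1)%:P) :
  X 0 ^+ n *: W = G * L -> exists G', W = G' * L.
Proof.
elim: n W G => [|n IHn] W G; first by rewrite scale1r; exists G.
rewrite exprSr -scalerA => /IHn[{}G WGL].
have dvdG i : mpoly_dvd (X 0) G`_i.
  apply: (euclid_mpoly2 copX); exists ((G * 'X)`_i - W`_i).
  have E : X 0 *: W = X 0 *: (G * 'X) - X 1 *: G.
    by rewrite WGL /L -!mul_polyC; ring.
  have {}E : X 0 * W`_i = X 0 * (G * 'X)`_i - X 1 * G`_i.
    by rewrite -!coefZ -coefB E.
  by rewrite [RHS]mulrC mulrBr E opprB addrC subrK.
have [g gP] := choice dvdG; pose G' := \poly_(i < size G) g i.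
have GE : G = X 0 *: G'.
  apply/polyP=> i; rewrite coefZ coef_poly; case: ltnP => [_|leG].
    by rewrite mulrC -gP.
  by rewrite mulr0 nth_default.
exists G'; have X0P : (X 0)%:P != 0 by rewrite polyC_eq0.
by apply: (mulfI X0P); rewrite mul_polyC WGL GE -mul_polyC mulrA.
Qed.

(** Pseudo-division leaves a constant remainder, which vanishes at the root. *)
Lemma dvd_linear W : (map_poly iota W).[slope] = 0 ->
  exists G, W = G * ('X * (X 0)%:P - (X 1)%:P).
Proof.
move=> W0; set L := _ - _.
have szL : size L = 2.
  rewrite /L mulrC mul_polyC size_polyDl size_scale ?size_polyX //.
  by rewrite size_polyN ltnS size_polyC_leq1.
have lcL : lead_coef L = X 0.
  by rewrite lead_coefE szL /L coefB mulrC mul_polyC coefZ coefX coefC mulr1 subr0.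
have L0 : L != 0 by rewrite -size_poly_eq0 szL.
have := Pdiv.Idomain.divp_eq W L; rewrite lcL => WE.
apply: (dvd_linear_strip (n := scalp W L) (G := divp W L)).
rewrite WE (_ : modp W L = 0) ?addr0 //.
have szR : (size (modp W L) <= 1)%N.
  by have := Pdiv.Idomain.ltn_modp W L; rewrite L0 szL.
move: szR WE => /size1_polyC ->; set c := _`_0 => WE.
suff -> : c = 0 by rewrite polyC0.
have LS : (map_poly iota L).[slope] = 0.
  rewrite /L rmorphB rmorphM /= map_polyX !map_polyC !hornerE /slope divfK ?subrr
    //.
  by rewrite iota_eq0.
have := congr1 (fun P => (map_poly iota P).[slope]) WE.
rewrite -mul_polyC rmorphM rmorphD rmorphM /= !map_polyC /= !hornerE W0 LS !mulr0
  add0r.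
by move/esym/eqP; rewrite iota_eq0 => /eqP.
Qed.

(** In the coordinates [(x, y, p)] the evaluation is [p |-> X_1 / X_0],
    the root of [p X_0 - X_1]. *)
Lemma tangent_eval_ker V : tangent_eval V = 0 -> exists G, V = G * tan.
Proof.
rewrite tangent_evalE => /dvd_linear[G VG]; exists (swap_lines 1 G).
by rewrite -[LHS](@swap_linesK C (-1)) VG opprK rmorphM.
Qed.

Lemma tangent_eval_tan : tangent_eval tan = 0.
Proof.
rewrite tangent_evalE swap_linesK rmorphB rmorphM /= map_polyX !map_polyC !hornerE.
by rewrite /slope divfK ?subrr // iota_eq0.
Qed.

Hypothesis sztan : (1 < size tan)%N.

Lemma tan_neq0 : tan != 0.
Proof. by rewrite -size_poly_gt0 ltnW. Qed.

Lemma tangent_eval_neq0 V : V != 0 -> (size V < size tan)%N -> tangent_eval V != 0.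
Proof.
move=> V0; apply: contraTneq => /tangent_eval_ker[G VG]; rewrite -leqNgt VG.
have G0 : G != 0 by apply: contraNneq V0 => G0; rewrite VG G0 mul0r.
by rewrite size_mul // ?tan_neq0 // (polySpred G0) addSn leq_addl.
Qed.

(** The tangent line at the generic point is a generic line: no curve in the
    dual plane contains all tangent lines. *)
Lemma tangent_line_eq0 p : (tangent_line p == 0) = (p == 0).
Proof.
have [->|p0] := eqVneq p 0; first by rewrite rmorph0 eqxx.
apply/negbTE; rewrite -tangent_evalC tangent_eval_neq0 ?polyC_eq0 //.
by rewrite size_polyC p0.
Qed.

(** If [tan = H G] and [V = H' G] up to scalars, with [G] of positive degree,
    then [tan] divides [V H] but not [V], so it divides [H], whose degree is too
    small. *)
Lemma coprimep_tan V : tangent_eval V != 0 -> coprimep tan V.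
Proof.
move=> evV; apply/negPn/negP=> ncop; set G := gcdp tan V.
have [[al H] /= al0 tanE] := Pdiv.Idomain.dvdpP _ _ (dvdp_gcdl tan V).
have [[be H'] /= be0 VE] := Pdiv.Idomain.dvdpP _ _ (dvdp_gcdr tan V).
rewrite -/G in tanE VE.
have G0 : G != 0 by rewrite gcdp_eq0 negb_and tan_neq0.
have szG : (1 < size G)%N by rewrite ltn_neqAle eq_sym ncop size_poly_gt0.
have H0 : H != 0.
  apply: contraNneq tan_neq0 => H0; move/eqP: tanE.
  by rewrite H0 mul0r scale_poly_eq0 (negPf al0).
have evH : tangent_eval H = 0.
  have /(congr1 tangent_eval) : be *: V * H = al *: tan * H' by rewrite VE tanE;
    ring.
  rewrite !rmorphM -!mul_polyC !rmorphM /= tangent_eval_tan mulr0 mul0r => /eqP.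
  by rewrite !mulf_eq0 (negPf evV) tangent_evalC tangent_line_eq0 (negPf be0) =>
    /eqP.
suff /(tangent_eval_neq0 H0)/eqP : (size H < size tan)%N by [].
rewrite -(size_scale tan al0) tanE size_mul //.
by rewrite -(subnKC szG) !addnS /= ltnS leq_addr.
Qed.

(** A Bezout relation ends at a nonzero element of [C[p, q]], which stays nonzero
    on the generic tangent line. *)
Lemma no_common_root V z : tangent_eval V != 0 ->
  (map_poly tangent_line tan).[z] = 0 -> (map_poly tangent_line V).[z] != 0.
Proof.
move=> /coprimep_tan/Bezout_coprimepP[[a b]] /=; rewrite -size_poly_eq1.
case/size_poly1P => c c0 abc tz; apply/eqP=> Vz.
have := congr1 (fun P => (map_poly tangent_line P).[z]) abc.
rewrite rmorphD !rmorphM /= map_polyC /= !hornerE tz Vz !mulr0 addr0.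
by move/esym/eqP; rewrite tangent_line_eq0 (negPf c0).
Qed.

Lemma tangent_eval_deriv_tan : tangent_eval tan^`() != 0.
Proof.
apply: tangent_eval_neq0; last exact: lt_size_deriv _ _ tan_neq0.
apply/eqP=> /polyP/(_ (size tan).-2); rewrite coef_deriv coef0 => /eqP.
have -> : (size tan).-2.+1 = (size tan).-1 by rewrite -(subnKC sztan).
rewrite -scaler_nat -mul_mpolyC mulf_eq0 mpolyC_eq0 Num.Theory.pnatr_eq0.
by rewrite -lead_coefE lead_coef_eq0 (negPf tan_neq0) -(subnKC sztan).
Qed.
End Kernel.

(** * The number of tangency points on a generic line *)

Section GenericDegree.
Variable C : numClosedFieldType.
Local Notation M := {mpoly C[2]}.
Variable X : 'I_2 -> M.
Local Notation tan := (tangency_poly X).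
Variable d : nat.
Hypothesis generic : forall D : M, D != 0 -> exists v, D.@[v] != 0 /\
  exists s : seq C, [/\ size s = d, uniq s &
    forall x, (x \in s) = root (map_poly (meval v) tan) x].

Lemma size_tan_gt1 : (0 < d)%N -> (1 < size tan)%N.
Proof.
move=> d0; rewrite ltnNge; apply/negP=> /size1_polyC; set c := _`_0 => tanE.
have [c0|c0] := eqVneq c 0.
  have [v [_ [s [_ _ rs]]]] := generic (oner_neq0 _).
  have [|x] := @poly_nonroot C (\prod_(z <- s) ('X - z%:P)).
    exact/monic_neq0/monic_prod_XsubC.
  by rewrite -/(root _ x) root_prod_XsubC rs tanE c0 rmorph0 root0.
have [v [cv [[|x s] [szs _ rs]]]] := generic c0.
  by rewrite -szs in d0.
have := rs x; rewrite mem_head tanE map_polyC rootC => /esym.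
by rewrite (negPf cv).
Qed.

Hypotheses (copX : coprime2 (X 0) (X 1)) (X0 : X 0 != 0).

(** A Bezout relation between the polynomial and its derivative survives at a
    line where its right-hand side and the leading coefficient do not vanish;
    at such a line there are as many roots as the degree. *)
Lemma size_tan : (0 < d)%N -> size tan = d.+1.
Proof.
move=> d0; have sztan := size_tan_gt1 d0.
have tan0 : tan != 0 by rewrite -size_poly_gt0 ltnW.
have cop : coprimep tan tan^`().
  apply: (coprimep_tan (@tofrac_inj M) copX X0 sztan).
  exact: (tangent_eval_deriv_tan (@tofrac_inj M) copX X0 sztan).
have [[a b] /=] := Bezout_coprimepP _ _ cop.
rewrite -size_poly_eq1 => /size_poly1P[c c0 abc].
have lc0 : lead_coef tan != 0 by rewrite lead_coef_eq0.
have [v [cv [s [szs us rs]]]] := generic (mulf_neq0 c0 lc0).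
move: cv; rewrite mevalM mulf_eq0 negb_or => /andP[cv lv].
set f := map_poly (meval v) tan in rs *.
have szf : size f = size tan by rewrite size_map_poly_id0.
have f0 : f != 0 by rewrite -size_poly_eq0 szf size_poly_eq0.
have copf : separable_poly f.
  rewrite separable_poly.unlock; apply/Bezout_coprimepP; exists (map_poly (meval
    v) a, map_poly (meval v) b) => /=.
  rewrite /f deriv_map -!rmorphM -rmorphD /= abc map_polyC -size_poly_eq1.
  by rewrite size_polyC cv.
have [r fr] := closed_field_poly_normal f.
have ur : uniq r.
  rewrite -separable_prod_XsubC -(eqp_separable (p := f)) // fr.
  by rewrite eqp_scale ?lead_coef_eq0.
rewrite -szf fr size_scale ?lead_coef_eq0 // size_prod_XsubC; congr _.+1.
rewrite -szs; apply/eqP; rewrite -(uniq_size_uniq us) // => x.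
by rewrite rs fr rootZ ?lead_coef_eq0 // root_prod_XsubC.
Qed.
End GenericDegree.

(** * Extension of injective substitutions to fractions *)

Section Endomorphisms.
Variables (A : idomainType) (K : fieldType) (iota : {rmorphism A -> K}).
Hypothesis iota_frac : forall f : K, exists pq : A * A, pq.2 != 0 /\ f = iota
  pq.1 / iota pq.2.
Hypothesis iota_inj : injective iota.

Lemma frac_lift (phi : {rmorphism A -> K}) : injective phi ->
  exists sigma : {rmorphism K -> K}, forall p, sigma (iota p) = phi p.
Proof.
move=> phi_inj; have [nd ndP] := choice iota_frac.
have inj0 (h : {rmorphism A -> K}) : injective h -> forall p, (h p == 0) = (p == 0).
  by move=> h_inj p; rewrite -(rmorph0 h) (inj_eq h_inj).
pose s f : K := phi (nd f).1 / phi (nd f).2.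
have sE f p q : q != 0 -> f = iota p / iota q -> s f = phi p / phi q.
  move=> q0 fE; have [d0 fE'] := ndP f.
  apply/eqP; rewrite /s eqr_div ?inj0 // -!rmorphM (inj_eq phi_inj) -(inj_eq
    iota_inj) !rmorphM.
  by rewrite -eqr_div ?inj0 // -fE -fE'.
have sD : zmod_morphism s.
  move=> f g; have [d0 fE] := ndP f; have [e0 gE] := ndP g.
  rewrite (@sE _ ((nd f).1 * (nd g).2 - (nd g).1 * (nd f).2) ((nd f).2 * (nd g).2)).
  - by rewrite /s !(rmorphB, rmorphM); field; rewrite !inj0 // ?d0 ?e0 /=.
  - by rewrite mulf_neq0.
  - by rewrite {1}fE {1}gE !(rmorphB, rmorphM); field; rewrite !inj0 // ?d0 ?e0 /=.
have sM : monoid_morphism s.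
  split=> [|f g]; first by rewrite (@sE _ 1 1) ?oner_neq0 ?rmorph1 ?divr1.
  have [d0 fE] := ndP f; have [e0 gE] := ndP g.
  rewrite (@sE _ ((nd f).1 * (nd g).1) ((nd f).2 * (nd g).2)).
  - by rewrite /s !rmorphM; field; rewrite !inj0 // ?d0 ?e0 /=.
  - by rewrite mulf_neq0.
  - by rewrite {1}fE {1}gE !rmorphM; field; rewrite !inj0 // ?d0 ?e0 /=.
pose sZ := GRing.isZmodMorphism.Build K K s sD.
pose sMM := GRing.isMonoidMorphism.Build K K s sM.
pose S : {rmorphism K -> K} := HB.pack s sZ sMM.
exists S => p; rewrite /= (@sE _ p 1) ?oner_neq0 ?rmorph1 ?divr1 //.
Qed.

Lemma frac_rmorph_ext (f g : {rmorphism K -> K}) :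
  (forall p, f (iota p) = g (iota p)) -> f =1 g.
Proof.
by move=> fg h; have [[p q] [_ ->]] := iota_frac h; rewrite !fmorph_div !fg.
Qed.
End Endomorphisms.

Lemma quad_factor_uniq (K : fieldType) (a b s1 s2 u1 u2 : K) : a != 0 ->
  a *: (('X - s1%:P) * ('X - s2%:P)) = b *: (('X - u1%:P) * ('X - u2%:P)) ->
  (s1 = u1 /\ s2 = u2) \/ (s1 = u2 /\ s2 = u1).
Proof.
move=> a0 E.
have ab : a = b.
  have := congr1 lead_coef E.
  by rewrite !lead_coefZ !lead_coefM !lead_coefXsubC !mulr1.
rewrite -ab in E; move/(scalerI a0): E => E.
have : perm_eq [:: s1; s2] [:: u1; u2].
  by apply: prod_XsubC_eq; rewrite !big_cons !big_nil !mulr1.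
move=> su; have := perm_mem su s1; rewrite inE eqxx /= !inE => /esym/orP[] /eqP s1E.
  left; split=> //; move: su; rewrite s1E perm_cons => /perm_small_eq => /(_ isT).
  by case.
right; split=> //; move: su; rewrite s1E -[[:: u1; u2]]/([:: u1] ++ [:: u2])
  perm_sym perm_catC /=.
by rewrite perm_cons => /perm_small_eq => /(_ isT); case.
Qed.

Lemma quad_formula (K : fieldType) (a b c s : K) : 2%:R != 0 :> K -> a != 0 ->
  b ^+ 2 - 4%:R * a * c = s ^+ 2 ->
  exists r1 r2, a * (- (r1 + r2)) = b /\ a * (r1 * r2) = c.
Proof.
move=> two0 a0 disc; exists ((- b + s) / (2%:R * a)), ((- b - s) / (2%:R * a));
  split.
  by field; rewrite a0 two0.
have four0 : 4%:R != 0 :> K by rewrite (natrM K 2 2) mulf_neq0.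
transitivity ((b ^+ 2 - s ^+ 2) / (4%:R * a)); last first.
  by rewrite -disc; field; rewrite a0 four0.
by field; rewrite a0 two0 four0.
Qed.

(** * The order-three symmetry of the tangency points *)

Section OrderThree.
Variable C : numClosedFieldType.
Local Notation M := {mpoly C[2]}.
Variables (K : fieldType) (iota : {rmorphism M -> K}).
Hypothesis iota_inj : injective iota.
Hypothesis iota_frac : forall f : K, exists pq : M * M, pq.2 != 0 /\ f = iota
  pq.1 / iota pq.2.
Local Notation "x %:F" := (iota x) : ring_scope.

Definition subst_at (T : 'I_2 -> K) : M -> K := mmap (iota \o @mpolyC 2 C) T.
HB.instance Definition _ T := GRing.RMorphism.on (subst_at T).

Lemma subst_atC T c : subst_at T c%:MP = (c%:MP)%:F.
Proof. by rewrite /subst_at mmapC. Qed.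
Lemma subst_atX T i : subst_at T 'X_i = T i.
Proof. by rewrite /subst_at mmapXU. Qed.

Lemma subst_at_eq T T' : T =1 T' -> subst_at T =1 subst_at T'.
Proof.
move=> TT'; apply: (@mpoly_rmorph_ext _ _ _ (subst_at T) (subst_at T')) => [c|i] /=.
  by rewrite !subst_atC.
by rewrite !subst_atX.
Qed.

Lemma subst_at_id : subst_at (fun j => ('X_j)%:F) =1 iota.
Proof.
apply: (@mpoly_rmorph_ext _ _ _ (subst_at _) iota) => [c|i] /=.
  by rewrite subst_atC.
by rewrite subst_atX.
Qed.

Variable X : 'I_2 -> M.
Local Notation tan := (tangency_poly X).
Local Notation theta := (tangent_line iota X).

Definition shift (r : K) : 'I_2 -> K := fun j => ('X_j)%:F + r * (X j)%:F.

Hypotheses (copX : coprime2 (X 0) (X 1)) (X0 : X 0 != 0).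

Let iX0 : (X 0)%:F != 0.
Proof. by rewrite (iota_eq0 iota_inj). Qed.

Lemma slopeM : slope iota X * (X 0)%:F = (X 1)%:F.
Proof. by rewrite /slope divfK. Qed.

Lemma on_tangent_line (r : K) p :
  (map_poly theta (on_lines 1 p)).[('X_0)%:F + (X 0)%:F * r] = subst_at (shift r) p.
Proof.
rewrite (horner_on_lines theta); move: p.
set h := fun j : 'I_2 => _.
apply: (@mpoly_rmorph_ext _ _ _ (mmap (theta \o @mpolyC 2 C) h) (subst_at (shift
  r))) => [c|] /=.
  by rewrite mmapC /= tangent_lineC subst_atC.
apply: ord2_ind; rewrite mmapXU subst_atX /h /shift /=; first by rewrite [r *
  _]mulrC.
by rewrite tangent_lineX1 tangent_lineX0 -slopeM; ring.
Qed.

(** Tangency at [m + r X(m)] means that the field there is parallel to the field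
    at [m]. *)
Lemma tan_at (r : K) :
  (X 0)%:F * (map_poly theta tan).[('X_0)%:F + (X 0)%:F * r] =
  (X 1)%:F * subst_at (shift r) (X 0) - (X 0)%:F * subst_at (shift r) (X 1).
Proof.
have [h [hE h0 ->]] : exists h : {rmorphism {poly M} -> K},
  [/\ forall p, h (on_lines 1 p) = subst_at (shift r) p, h ('X_0)%:P = slope iota
    X &
      (map_poly theta tan).[('X_0)%:F + (X 0)%:F * r] = h tan].
  exists (horner_eval (('X_0)%:F + (X 0)%:F * r) \o map_poly theta).
  split=> // [p|]; first by rewrite -on_tangent_line.
  by rewrite /= map_polyC /horner_eval hornerC /= tangent_lineX0.
rewrite tangency_polyE rmorphB rmorphM h0.
transitivity ((X 0)%:F * (slope iota X * subst_at (shift r) (X 0) - subst_at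
  (shift r) (X 1))).
  by congr (_ * (_ * _ - _)); apply: hE.
by rewrite -slopeM; ring.
Qed.

(** Abscissa of the point [m + t X(m)] as a polynomial in [t]. *)
Definition along_field : {poly K} := (('X_0)%:F)%:P + ((X 0)%:F)%:P * 'X.

Lemma shifted_fieldE (g : {rmorphism M -> K}) j :
  map_poly g (shifted_field X j) =
  mmap (polyC \o g \o @mpolyC 2 C) (fun i => (g 'X_i)%:P + g (X i) *: 'X) (X j).
Proof.
set h := fun i => _; rewrite /shifted_field; move: (X j).
pose T : {rmorphism M -> {poly K}} := map_poly g \o mmap (polyC \o @mpolyC 2 C)
  (fun i => ('X_i)%:P + X i *: 'X).
apply: (@mpoly_rmorph_ext _ _ _ T (mmap (polyC \o g \o @mpolyC 2 C) h)) => [c|i] /=.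
  by rewrite mmapC /= map_polyC /= mmapC.
by rewrite /T /= !mmapXU rmorphD /= map_polyC /= map_polyZ /= map_polyX.
Qed.

Lemma shifted_field_along j :
  map_poly iota (shifted_field X j) = map_poly theta (on_lines 1 (X j)) \Po
    along_field.
Proof.
have -> : map_poly theta (on_lines 1 (X j)) \Po along_field =
    (map_poly (polyC \o theta) (on_lines 1 (X j))).[along_field].
  by rewrite /comp_poly -map_poly_comp.
rewrite (horner_on_lines (polyC \o theta)) shifted_fieldE; move: (X j).
set h := fun i => _; set h' := fun i => _.
apply: (@mpoly_rmorph_ext _ _ _ (mmap (polyC \o iota \o @mpolyC 2 C) h) (mmap
  ((polyC \o theta) \o @mpolyC 2 C) h')) => [c|] /=.
  by rewrite !mmapC /= tangent_lineC.
apply: ord2_ind; rewrite !mmapXU /h /h' /= /along_field; first by rewrite mul_polyC.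
rewrite tangent_lineX1 tangent_lineX0 -slopeM -mul_polyC.
by rewrite !(polyCM, polyCB); ring.
Qed.

(** Both sides express tangency at [m + t X(m)]; restricting a coordinate of the
    field to the tangent line and then to its parametrization by [t] is the same
    as shifting it. *)
Lemma Qpoly_along :
  map_poly iota (Qpoly X) = ((X 0)%:F)%:P * (map_poly theta tan \Po along_field).
Proof.
have mapQ (A B : {poly M}) a b : map_poly iota (A * b%:P - B * a%:P) =
    map_poly iota A * (b%:F)%:P - map_poly iota B * (a%:F)%:P.
  rewrite -(map_polyC iota a) -(map_polyC iota b) -!(rmorphM (map_poly iota)).
  exact: (rmorphB (map_poly iota)).
have mapT (A B : {poly M}) : map_poly theta (('X_0)%:P * A - B) =
    (slope iota X)%:P * map_poly theta A - map_poly theta B.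
  rewrite -tangent_lineX0 -(map_polyC theta) -(rmorphM (map_poly theta)).
  exact: (rmorphB (map_poly theta)).
transitivity ((map_poly theta (on_lines 1 (X 0)) \Po along_field) * ((X 1)%:F)%:P
   - (map_poly theta (on_lines 1 (X 1)) \Po along_field) * ((X 0)%:F)%:P).
  by rewrite /Qpoly mapQ; congr (_ * _ - _ * _); apply: shifted_field_along.
rewrite tangency_polyE mapT comp_polyB comp_polyM comp_polyC -slopeM polyCM.
have alg (t x u w : {poly K}) : u * (t * x) - w * x = x * (t * u - w) by ring.
exact: alg.
Qed.

Hypothesis sztan : size tan = 4.

Let sztan1 : (1 < size tan)%N.
Proof. by rewrite sztan. Qed.

Lemma size_along : size along_field = 2.
Proof.
rewrite /along_field addrC mul_polyC size_polyDl size_scale ?size_polyX //.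
by rewrite ltnS size_polyC_leq1.
Qed.

Lemma size_map_iota P : size (map_poly iota P) = size P.
Proof. by rewrite size_map_inj_poly // rmorph0. Qed.

Lemma size_Qpoly : size (Qpoly X) = 4.
Proof.
rewrite -size_map_iota Qpoly_along mul_polyC size_scale // size_comp_poly2
  ?size_along //.
rewrite size_map_inj_poly ?rmorph0 ?sztan // => p q pq; apply/eqP.
by rewrite -subr_eq0 -(tangent_line_eq0 iota_inj copX X0 sztan1) rmorphB /= pq
  subrr.
Qed.

Lemma horner_along t : along_field.[t] = ('X_0)%:F + (X 0)%:F * t.
Proof. by rewrite /along_field hornerD hornerM !hornerC hornerX. Qed.

Lemma Qpoly0 : (Qpoly X)`_0 = 0.
Proof.
apply: iota_inj; rewrite -coef_map -horner_coef0 Qpoly_along hornerM horner_comp.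
rewrite horner_along mulr0 addr0 rmorph0.
rewrite (_ : (map_poly theta tan).[_] = 0) ?mulr0 //.
exact: (tangent_eval_tan iota_inj X0).
Qed.

(** This is, up to the square of [X_0], the derivative of the tangency polynomial
    at [m], which is nonzero because the tangency at [m] is simple. *)
Lemma Qpoly1 : (Qpoly X)`_1 != 0.
Proof.
rewrite -(iota_eq0 iota_inj) -coef_map -[_`_1]mulr1n -coef_deriv -horner_coef0.
rewrite Qpoly_along mul_polyC derivZ hornerZ deriv_comp hornerM horner_comp
  horner_along mulr0 addr0.
have -> : along_field^`() = ((X 0)%:F)%:P.
  by rewrite /along_field derivD derivC mul_polyC derivZ derivX add0r alg_polyC.
rewrite hornerC deriv_map !mulf_eq0 (negPf iX0) /= orbF.
exact: (tangent_eval_deriv_tan iota_inj copX X0 sztan1).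
Qed.

Lemma Qpoly_Ppoly : Qpoly X = Ppoly X * 'X.
Proof.
rewrite /Ppoly -{1}[Qpoly X](poly_take_drop 1).
rewrite (_ : take_poly 1 _ = 0) ?add0r ?expr1 //.
apply/polyP=> -[|i]; by rewrite coef_take_poly coef0 //= Qpoly0.
Qed.

Lemma Ppoly2 : (Ppoly X)`_2 != 0.
Proof.
have : lead_coef (Qpoly X) != 0 by rewrite lead_coef_eq0 -size_poly_eq0 size_Qpoly.
by rewrite lead_coefE size_Qpoly /Ppoly coef_drop_poly.
Qed.

Lemma size_Ppoly : (size (Ppoly X) <= 3)%N.
Proof. by rewrite /Ppoly size_drop_poly size_Qpoly. Qed.

Definition splits_as (r1 r2 : K) :=
  map_poly iota (Ppoly X) = ((Ppoly X)`_2)%:F *: (('X - r1%:P) * ('X - r2%:P)).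

Lemma splits_asC r1 r2 : splits_as r1 r2 -> splits_as r2 r1.
Proof. by rewrite /splits_as [_ * ('X - r2%:P)]mulrC. Qed.

Lemma splits_as_exist s : quad_disc (Ppoly X) = s ^+ 2 -> exists r1 r2, splits_as
  r1 r2.
Proof.
have two0 : (2%:R : K) != 0.
  rewrite -(rmorph_nat iota) (iota_eq0 iota_inj) -(rmorph_nat (@mpolyC 2 C))
    mpolyC_eq0.
  by rewrite Num.Theory.pnatr_eq0.
rewrite /quad_disc => /(congr1 iota); set a := (Ppoly X)`_2; set b := (Ppoly
  X)`_1; set c := (Ppoly X)`_0.
move=> disc0; have disc : b%:F ^+ 2 - 4%:R * a%:F * c%:F = s%:F ^+ 2.
  by rewrite -(rmorph_nat iota) -!rmorphXn -!rmorphM -rmorphB.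
have a0 : a%:F != 0 by rewrite (iota_eq0 iota_inj) Ppoly2.
have [r1 [r2 [E1 E2]]] := quad_formula two0 a0 disc.
exists r1, r2; rewrite /splits_as -/a.
have -> : ('X - r1%:P) * ('X - r2%:P) = 'X^2 + (- (r1 + r2))%:P * 'X + (r1 * r2)%:P.
  by rewrite polyCN polyCD polyCM; ring.
apply/polyP=> i; rewrite coefZ coef_map !coefD coefXn coefCM coefX coefC.
case: i => [|[|[|i]]] /=.
- by rewrite mulr0 !add0r E2.
- by rewrite mulr1 add0r addr0 E1.
- by rewrite mulr0 !addr0 mulr1.
by rewrite nth_default ?(leq_trans size_Ppoly) // rmorph0 mulr0 !addr0 mulr0.
Qed.

Lemma Qpoly_splits r1 r2 : splits_as r1 r2 ->
  map_poly iota (Qpoly X) =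
    ((Ppoly X)`_2)%:F *: ('X * (('X - r1%:P) * ('X - r2%:P))).
Proof.
move=> sp; rewrite Qpoly_Ppoly (rmorphM (map_poly iota)) /= map_polyX sp.
by rewrite mulrC -scalerAr.
Qed.

Lemma splits_neq0 r1 r2 : splits_as r1 r2 -> r1 != 0 /\ r2 != 0.
Proof.
move=> sp; have := Qpoly1; rewrite -(iota_eq0 iota_inj) Qpoly_Ppoly coefMX /=.
rewrite -coef_map sp coefZ -horner_coef0 hornerM !hornerXsubC !sub0r mulrNN.
by rewrite !mulf_eq0 !negb_or => /and3P[_ -> ->].
Qed.

Lemma splits_tan r1 r2 : splits_as r1 r2 ->
  (map_poly theta tan).[('X_0)%:F + (X 0)%:F * r1] = 0.
Proof.
move=> sp; have := congr1 (fun P => P.[r1]) Qpoly_along.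
rewrite (Qpoly_splits sp) hornerZ !hornerM horner_comp horner_along hornerXsubC
  subrr.
rewrite mul0r !mulr0 hornerC => /esym/eqP.
by rewrite mulf_eq0 (negPf iX0) => /eqP.
Qed.

Lemma tangent_eval_on_lines p : tangent_eval iota X (on_lines 1 p) = p%:F.
Proof.
rewrite -subst_at_id -[RHS](subst_at_eq (T := shift 0)); last first.
  by move=> j; rewrite /shift mul0r addr0.
by rewrite -on_tangent_line mulr0 addr0.
Qed.

(** A polynomial restricted to the tangent line does not vanish at [m] unless it
    is zero, hence does not vanish at another tangency point. *)
Lemma subst_shift_eq0 r p :
  (map_poly theta tan).[('X_0)%:F + (X 0)%:F * r] = 0 ->
  (subst_at (shift r) p == 0) = (p == 0).
Proof.
move=> tr; have [->|p0] := eqVneq p 0; first by rewrite rmorph0 eqxx.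
apply/negbTE; rewrite -on_tangent_line.
apply: (no_common_root iota_inj copX X0 sztan1) tr.
by rewrite tangent_eval_on_lines (iota_eq0 iota_inj).
Qed.

Lemma field_along_line r :
  (map_poly theta tan).[('X_0)%:F + (X 0)%:F * r] = 0 ->
  exists2 l, l != 0 & forall j, subst_at (shift r) (X j) = l * (X j)%:F.
Proof.
move=> tr; have := tan_at r; rewrite tr mulr0 => /esym/eqP; rewrite subr_eq0 =>
  /eqP E.
exists (subst_at (shift r) (X 0) / (X 0)%:F).
  by rewrite mulf_neq0 ?invr_eq0 ?subst_shift_eq0.
apply: ord2_ind; first by rewrite divfK.
by apply: (mulfI iX0); rewrite -E mulrCA mulrA divfK // mulrC.
Qed.

Lemma map_Qpoly (g : {rmorphism M -> K}) :
  map_poly g (Qpoly X) = map_poly g (shifted_field X 0) * (g (X 1))%:P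
                       - map_poly g (shifted_field X 1) * (g (X 0))%:P.
Proof.
have mapQ (A B : {poly M}) a b : map_poly g (A * b%:P - B * a%:P) =
    map_poly g A * (g b)%:P - map_poly g B * (g a)%:P.
  rewrite -(map_polyC g a) -(map_polyC g b) -!(rmorphM (map_poly g)).
  exact: (rmorphB (map_poly g)).
exact: mapQ.
Qed.

Lemma shifted_field_shift r l j :
  (forall j, subst_at (shift r) (X j) = l * (X j)%:F) ->
  map_poly (subst_at (shift r)) (shifted_field X j) =
  map_poly iota (shifted_field X j) \Po (r%:P + l *: 'X).
Proof.
move=> hl; rewrite (shifted_fieldE (subst_at (shift r))) (shifted_fieldE iota).
move: (X j); set q := r%:P + _.
set h := fun i => _; set h' := fun i => _.
pose T : {rmorphism M -> {poly K}} := comp_poly q \o mmap (polyC \o iota \o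
  @mpolyC 2 C) h'.
pose T' : {rmorphism M -> {poly K}} := mmap ((polyC \o subst_at (shift r)) \o
  @mpolyC 2 C) h.
apply: (@mpoly_rmorph_ext _ _ _ T' T) => [c|i].
  by rewrite /T /T' /= !mmapC /= comp_polyC subst_atC.
rewrite /T /T' /= !mmapXU /h /h' /= hl subst_atX /shift.
rewrite comp_polyD comp_polyC comp_polyZ comp_polyX /q -!mul_polyC !(polyCD,
  polyCM).
ring.
Qed.

(** The point with parameter [t] on the tangent line at [m + r X(m)] is the point
    with parameter [r + l t] on the tangent line at [m]. *)
Lemma Qpoly_shift r l :
  (forall j, subst_at (shift r) (X j) = l * (X j)%:F) ->
  map_poly (subst_at (shift r)) (Qpoly X) =
  l *: (map_poly iota (Qpoly X) \Po (r%:P + l *: 'X)).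
Proof.
move=> hl; rewrite (map_Qpoly (subst_at (shift r))) (map_Qpoly iota) /= !hl.
rewrite comp_polyB !comp_polyM !comp_polyC !polyCM.
transitivity ((map_poly iota (shifted_field X 0) \Po (r%:P + l *: 'X)) * (l%:P *
  ((X 1)%:F)%:P)
  - (map_poly iota (shifted_field X 1) \Po (r%:P + l *: 'X)) * (l%:P * ((X
    0)%:F)%:P)).
  by congr (_ * _ - _ * _); apply: shifted_field_shift.
have alg (a b u w : {poly K}) : u * (l%:P * a) - w * (l%:P * b) = l *: (u * a - w
  * b).
  by rewrite -mul_polyC; ring.
exact: alg.
Qed.

(** Applied to [Q], [sigma] yields the parameters of the same three points,
    measured from [m + r X(m)]: they are [- r / l] for [m] and [(r' - r) / l] for
    the remaining one, in some order. *)
Lemma endo_permutes r r' (sigma : {rmorphism K -> K}) : splits_as r r' ->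
  (forall p, sigma p%:F = subst_at (shift r) p) ->
  (forall j, sigma (shift r j) = ('X_j)%:F) /\ (forall j, sigma (shift r' j) =
    shift r' j)
  \/ (forall j, sigma (shift r j) = shift r' j) /\ (forall j, sigma (shift r' j)
    = ('X_j)%:F).
Proof.
move=> sp sE; have [l l0 hl] := field_along_line (splits_tan sp).
have a0 : ((Ppoly X)`_2)%:F != 0 by rewrite (iota_eq0 iota_inj) Ppoly2.
set a := ((Ppoly X)`_2)%:F in a0.
have sa0 : sigma a != 0 by rewrite fmorph_eq0.
have : (sigma r = - r / l /\ sigma r' = (r' - r) / l) \/
       (sigma r = (r' - r) / l /\ sigma r' = - r / l).
  apply: (@quad_factor_uniq K (sigma a) (l * a * l * l ^+ 2)) => //.
  have X0P : ('X : {poly K}) != 0 by rewrite polyX_eq0.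
  apply: (mulfI X0P).
  have L : 'X * (sigma a *: (('X - (sigma r)%:P) * ('X - (sigma r')%:P))) =
      map_poly (subst_at (shift r)) (Qpoly X).
    transitivity (map_poly sigma (map_poly iota (Qpoly X))).
      rewrite (Qpoly_splits sp) -/a map_polyZ (rmorphM (map_poly sigma)) (rmorphM
        (map_poly sigma)) /=.
      by rewrite map_polyX !map_polyXsubC -scalerAr.
    by rewrite -map_poly_comp; apply: eq_map_poly => p /=; rewrite sE.
  rewrite L (Qpoly_shift hl) (Qpoly_splits sp) -/a.
  rewrite comp_polyZ !comp_polyM !comp_polyB !comp_polyC comp_polyX -!mul_polyC.
  (* Identities that clear the denominator [l] inside polynomial constants. *)
  have e1 : l%:P * (- r / l)%:P = (- r%:P : {poly K}) by rewrite -polyCM -polyCN;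
    congr _%:P; field.
  have e2 : l%:P * ((r' - r) / l)%:P = (r'%:P - r%:P : {poly K}) by rewrite
    -polyCM -polyCB; congr _%:P; field.
  have eA : (l * a * l * l ^+ 2)%:P = l%:P * a%:P * l%:P * l%:P ^+ 2 :> {poly K}.
    by rewrite !polyCM.
  rewrite eA.
  transitivity (l%:P * (a%:P * (l%:P * 'X * ((l%:P * 'X - l%:P * (- r / l)%:P) *
    (l%:P * 'X - l%:P * ((r' - r) / l)%:P)))) : {poly K}).
    by rewrite e1 e2; ring.
  by ring.
have step t t' : sigma t = (t' - r) / l -> forall j, sigma (shift t j) = shift t' j.
  move=> st j; rewrite /shift rmorphD rmorphM /= !sE subst_atX hl st /shift;
    field; exact: l0.
have shift0 j : shift 0 j = ('X_j)%:F by rewrite /shift mul0r addr0.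
case=> [[s1 s2]|[s1 s2]]; [left|right]; split=> j.
- by rewrite (step r 0) ?sub0r.
- exact: (step r' r').
- exact: (step r r').
- by rewrite (step r' 0) ?sub0r.
Qed.

Lemma endo_ext (f g : {rmorphism K -> K}) :
  (forall c, f (c%:MP)%:F = g (c%:MP)%:F) -> (forall j, f ('X_j)%:F = g
    ('X_j)%:F) -> f =1 g.
Proof.
move=> fgC fgX; apply: (frac_rmorph_ext iota_frac).
exact: (@mpoly_rmorph_ext _ _ _ (f \o iota) (g \o iota)).
Qed.

Lemma shift_id r : (forall j, shift r j = ('X_j)%:F) -> r = 0.
Proof.
move=> /(_ 0); rewrite /shift => /eqP; rewrite -subr_eq0 addrC addKr.
by rewrite mulf_eq0 (negPf iX0) orbF => /eqP.
Qed.

(** If [sigma] sent [T] to the identity and fixed [T'], it would be an involution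
    with [sigma o sigma' = sigma'].  Either [sigma'] is an involution too, and
    then [sigma] is the identity; or [sigma' o sigma] is the identity, and then
    [sigma' = sigma], which again makes [sigma] the identity. *)
Lemma endo_shift r r' : splits_as r r' ->
  exists sigma : {rmorphism K -> K}, [/\ forall p, sigma p%:F = subst_at (shift
    r) p,
    forall j, sigma (shift r j) = shift r' j & forall j, sigma (shift r' j) =
      ('X_j)%:F].
Proof.
move=> sp; have sp' := splits_asC sp; have [r0 r'0] := splits_neq0 sp.
have inj q q' : splits_as q q' -> injective (subst_at (shift q)).
  move=> spq p p' pp'; apply/eqP.
  by rewrite -subr_eq0 -(subst_shift_eq0 _ (splits_tan spq)) rmorphB /= pp' subrr.
have [s sE] := frac_lift iota_frac iota_inj (inj _ _ sp).
have [s' s'E] := frac_lift iota_frac iota_inj (inj _ _ sp').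
have sC c : s (c%:MP)%:F = (c%:MP)%:F by rewrite sE /= subst_atC.
have s'C c : s' (c%:MP)%:F = (c%:MP)%:F by rewrite s'E /= subst_atC.
have sX j : s ('X_j)%:F = shift r j by rewrite sE /= subst_atX.
have s'X j : s' ('X_j)%:F = shift r' j by rewrite s'E /= subst_atX.
have [[A1 A2]|[B1 B2]] := endo_permutes sp sE; last by exists s.
exfalso.
  have ss : s \o s =1 idfun.
    by apply: endo_ext => [c|j] /=; rewrite ?sC // sX A1.
  have ss' : s \o s' =1 s'.
    by apply: endo_ext => [c|j] /=; rewrite ?s'C ?sC // s'X A2.
  have sid : s =1 idfun -> False.
    by move=> sid; move/eqP: r0; apply; apply: shift_id => j; rewrite -sX sid.
  have [[A1' A2']|[B1' B2']] := endo_permutes sp' s'E.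
    have s's' : s' \o s' =1 idfun.
      by apply: endo_ext => [c|j] /=; rewrite ?s'C // s'X A1'.
    by apply: sid => f; rewrite -[f in LHS]s's' /= -[LHS]/((s \o s') (s' f)) ss'
      -[LHS]/((s' \o s') f) s's'.
  have s's : s' \o s =1 idfun.
    by apply: endo_ext => [c|j] /=; rewrite ?sC ?s'C // sX B2'.
  have es f : s' f = s f.
    by rewrite -[f in LHS]ss /= -[LHS]/((s' \o s) (s f)) s's.
  by apply: sid => f; rewrite -es -ss' /= es -[LHS]/((s \o s) f) ss.
Qed.
End OrderThree.

(** * Rational maps of the plane *)

Lemma fraction_quotient (A : idomainType) (f : {fraction A}) :
  exists pq : A * A, pq.2 != 0 /\ f = tofrac pq.1 / tofrac pq.2.
Proof.
elim/quotW: f => x; have d0 := denom_ratioP x.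
exists (frac x); split=> //; have dF0 : tofrac (frac x).2 != 0 by rewrite
  tofrac_eq0.
apply: (mulIf dF0); rewrite divfK //; unlock FracField.tofrac.
rewrite -[LHS]FracField.pi_mul; apply/eqmodP; rewrite /= FracField.equivfE
  /FracField.mulf.
by rewrite !numden_Ratio ?(oner_neq0, mulr1, mulf_neq0) // mulrC.
Qed.

Section Main.
Variable C : numClosedFieldType.
Local Notation M := {mpoly C[2]}.

(** If [X_0] vanished, the tangency polynomial would be a constant, and a generic
    line would have no tangency point. *)
Lemma foliation_tangency_poly (F : foliation C) (X : 'I_2 -> M) d :
  (0 < d)%N -> has_degree F d -> no_common_factor X -> defined_by F X ->
  [/\ coprime2 (X 0) (X 1), X 0 != 0 & size (tangency_poly X) = d.+1].
Proof.
move=> d0 hdeg hX hF.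
have generic := generic_tangencies hdeg hX hF.
have sz1 := size_tan_gt1 generic d0.
have copX : coprime2 (X 0) (X 1).
  by move=> p p0 p1; apply: hX; apply: ord2_ind.
have X0 : X 0 != 0.
  apply: contraTneq sz1 => X00.
  have /mpoly_unitP[c c0 X1c] : X 1 \is a GRing.unit.
    by apply: copX; [exists 0; rewrite X00 mul0r | exists 1; rewrite mul1r].
  rewrite -leqNgt tangency_polyE X00 X1c rmorph0 mulr0 sub0r on_linesC.
  by rewrite size_polyN size_polyC_leq1.
by split=> //; apply: size_tan.
Qed.

(** An endomorphism extends an injective substitution, so no denominator
    vanishes along [T]. *)
Lemma ratfun_subst_endo (T : ratmap C) (sigma : {rmorphism ratfun C -> ratfun C})
  f h :
  (forall p, sigma (tofrac p) = mpoly_subst p T) -> ratfun_subst f T h <-> h =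
    sigma f.
Proof.
move=> sE; split=> [[p [q [-> _ ->]]]|->].
  by rewrite fmorph_div /= !sE.
have [[p q] /= [q0 ->]] := fraction_quotient f; exists p, q; split=> //.
  by rewrite -sE fmorph_eq0 tofrac_eq0.
by rewrite fmorph_div /= !sE.
Qed.

Lemma mpoly_subst_rid (p : M) : mpoly_subst p (@rid C) = tofrac p.
Proof. exact: (subst_at_id (@tofrac M)). Qed.

Lemma periodic3 (T T' : ratmap C) :
  (forall h, is_comp T T h <-> h = T') -> is_comp T T' (@rid C) ->
  T <> @rid C -> T' <> @rid C -> periodic 3 T.
Proof.
move=> TT TT' T1 T'1.
have comp_id (S U : ratmap C) : is_comp S (@rid C) U <-> U = S.
  pose idK : {rmorphism ratfun C -> ratfun C} := idfun.
  have E p : idK (tofrac p) = mpoly_subst p (@rid C) by rewrite mpoly_subst_rid.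
  split=> [SU|-> j]; last exact/(ratfun_subst_endo _ _ E).
  by apply: funext => j; exact/(ratfun_subst_endo _ _ E).
have iter0 (U : ratmap C) : is_iter 0 T U <-> U = @rid C.
  by split=> [|->//] /funext.
have iter1 (U : ratmap C) : is_iter 1 T U <-> U = T.
  split=> [[V /iter0 ->] /comp_id //|->]; exists (@rid C); first exact/iter0.
  exact/comp_id.
have iter2 (U : ratmap C) : is_iter 2 T U <-> U = T'.
  split=> [[V /iter1 ->] /TT //|->]; exists T; first exact/iter1.
  exact/TT.
split=> //; first by exists T' => //; apply/iter2.
move=> [|[|[|k]]] //= _ It.
  by apply: T1; apply/esym/iter1.
by apply: T'1; apply/esym/iter2.
Qed.

Lemma order_three_pair (T T' : ratmap C) (sg sg' : {rmorphism ratfun C -> ratfun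
  C}) :
  (forall p, sg (tofrac p) = mpoly_subst p T) ->
  (forall p, sg' (tofrac p) = mpoly_subst p T') ->
  (forall j, sg (T j) = T' j) -> (forall j, sg (T' j) = @rid C j) ->
  (forall j, sg' (T j) = @rid C j) -> T <> @rid C -> T' <> @rid C ->
  [/\ periodic 3 T, is_comp T' T (@rid C) & is_comp T T' (@rid C)].
Proof.
move=> sE s'E sT sT' s'T T1 T'1.
have TT' : is_comp T T' (@rid C).
  by move=> j; apply/(ratfun_subst_endo _ _ s'E); rewrite s'T.
have T'T : is_comp T' T (@rid C).
  by move=> j; apply/(ratfun_subst_endo _ _ sE); rewrite sT'.
split=> //; apply: (periodic3 _ TT' T1 T'1) => h; split=> [Th|-> j].
  by apply: funext => j; have /(ratfun_subst_endo _ _ sE) -> := Th j; rewrite sT.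
by apply/(ratfun_subst_endo _ _ sE); rewrite sT.
Qed.

Lemma foliation_maps (F : foliation C) (X : 'I_2 -> M) :
  has_degree F 3 -> no_common_factor X -> defined_by F X ->
  forall s : M, quad_disc (Ppoly X) = s ^+ 2 ->
  (exists r1 r2 : ratfun C, quad_roots (Ppoly X) r1 r2) /\
  (forall r1 r2 : ratfun C, quad_roots (Ppoly X) r1 r2 ->
    [/\ birational (Tmap X r1), birational (Tmap X r2),
        periodic 3 (Tmap X r1), periodic 3 (Tmap X r2) &
        is_comp (Tmap X r1) (Tmap X r2) (@rid C)]).
Proof.
move=> hdeg hX hF s hs.
have [copX X0 sz] := foliation_tangency_poly (isT : 0 < 3)%N hdeg hX hF.
have injF := @tofrac_inj M; have fracF := @fraction_quotient M.
have roots_quad r1 r2 : quad_roots (Ppoly X) r1 r2 -> splits_as (@tofrac M) X r1 r2.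
  by case.
split.
  have [r1 [r2 sp]] := splits_as_exist injF copX X0 sz hs.
  exists r1, r2; split=> //; exact: (Ppoly2 injF copX X0 sz).
have one r r' : splits_as (@tofrac M) X r r' -> [/\ periodic 3 (Tmap X r),
    is_comp (Tmap X r') (Tmap X r) (@rid C) & is_comp (Tmap X r) (Tmap X r')
      (@rid C)].
  move=> sp; have sp' := splits_asC sp.
  have [sg [sE sr sr']] := endo_shift injF fracF copX X0 sz sp.
  have [sg' [s'E s'r' s'r]] := endo_shift injF fracF copX X0 sz sp'.
  have [r0 r'0] := splits_neq0 injF copX X0 sz sp.
  have nid q : q != 0 -> Tmap X q <> @rid C.
    move=> /eqP q0 Tq; apply/q0/(shift_id injF X0) => j.
    exact: (congr1 (fun T : ratmap C => T j) Tq).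
  exact: (order_three_pair sE s'E sr sr' s'r (nid r r0) (nid r' r'0)).
move=> r1 r2 /roots_quad sp.
have [p1 c21 c12] := one _ _ sp; have [p2 _ _] := one _ _ (splits_asC sp).
by split=> //; [exists (Tmap X r2)|exists (Tmap X r1)].
Qed.
End Main.

Theorem proposition5p2 (R : realType) (F : foliation R[i])
    (X : 'I_2 -> {mpoly R[i][2]})
    (hdeg : has_degree F 3)
    (hX : no_common_factor X)
    (hF : defined_by F X)
    (s : {mpoly R[i][2]})
    (hs : quad_disc (Ppoly X) = s ^+ 2) :
  (exists r1 r2 : ratfun R[i], quad_roots (Ppoly X) r1 r2) /\
  (forall r1 r2 : ratfun R[i], quad_roots (Ppoly X) r1 r2 ->
    [/\ birational (Tmap X r1), birational (Tmap X r2),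
        periodic 3 (Tmap X r1), periodic 3 (Tmap X r2) &
        is_comp (Tmap X r1) (Tmap X r2) (@rid R[i])]).
Proof.
exact: (@foliation_maps R[i] F X hdeg hX hF s hs).
Qed.
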